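(* Let $\psi:M^n\to\mathbb{M}^{n+1}_c\subset\mathbb{R}^{n+2}_q$ be a connected orientable (non-degenerate) hypersurface, fix $k\in\{0,1,\dots,n-1\}$, and assume $H_k$ is constant. Then $L_k\psi=A\psi+b$ for some constant matrix $A\in\mathbb{R}^{(n+2)\times(n+2)}$ self-adjoint with respect to $\langle\,,\rangle$ and some non-zero constant vector $b\in\mathbb{R}^{n+2}_q$ if and only if either (i) $c=1$ and $M$ is an open piece of one of the totally umbilical hypersurfaces of $\mathbb{S}^{n+1}_1$: $\mathbb{S}^n(r)$ with $r>1$; $\mathbb{H}^n(-r)$ with $r>0$; $\mathbb{S}^n_1(r)$ with $0<r<1$; $\mathbb{R}^n$; or (ii) $c=-1$ and $M$ is an open piece of one of the totally umbilical hypersurfaces of $\mathbb{H}^{n+1}_1$: $\mathbb{H}^n_1(-r)$ with $r>1$; $\mathbb{H}^n(-r)$ with $0<r<1$; $\mathbb{S}^n_1(r)$ with $r>0$; $\mathbb{R}^n_1$; where in each case the totally umbilical hypersurface is non-totally-geodesic, i.e. of the form $\{x\in\mathbb{M}^{n+1}_c:\langle a,x\rangle=\tau\}$ with $a\ne0$ constant, $\tau\neq0$, $\langle a,a\rangle-c\tau^2\neq0$.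
   Context: Notation and conventions. $\mathbb{R}^{n+2}_q$ is $\mathbb{R}^{n+2}$ with metric $\langle\,,\rangle=-dx_1^2+c\,dx_2^2+dx_3^2+\dots+dx_{n+2}^2$, where $c\in\{1,-1\}$ and $q=1$ if $c=1$, $q=2$ if $c=-1$. $\mathbb{M}^{n+1}_c=\{x\in\mathbb{R}^{n+2}_q:\langle x,x\rangle=c\}$ (De Sitter space $\mathbb{S}^{n+1}_1$ if $c=1$, anti De Sitter space $\mathbb{H}^{n+1}_1$ if $c=-1$). $\mathbb{S}^{p}_{s}(r)=\{x\in\mathbb{R}^{p+1}_s:\langle x,x\rangle=r^2\}$, $\mathbb{H}^p_s(-r)=\{x\in\mathbb{R}^{p+1}_{s+1}:\langle x,x\rangle=-r^2\}$, $\mathbb{S}^p=\mathbb{S}^p_0$, $\mathbb{H}^p=\mathbb{H}^p_0$; the totally umbilical hypersurfaces are intersections of $\mathbb{M}^{n+1}_c$ with affine hyperplanes, and the listed names give their intrinsic isometry type. A hypersurface has unit normal $N$ with $\langle N,N\rangle=\varepsilon\in\{\pm1\}$ and shape operator $SX=-\nabla^0_XN$. Write $\det(tI-S)=\sum_{j=0}^n a_jt^{n-j}$ ($a_0=1$); $H_k$ is defined by $\binom{n}{k}H_k=(-\varepsilon)^ka_k$. The Newton transformation is $P_k=\sum_{j=0}^ka_{k-j}S^j$, and $L_kf=\operatorname{tr}(P_k\circ\nabla^2f)$ with $\nabla^2f(X)=\nabla_X\nabla f$; $L_k\psi$ is computed componentwise. $A$ self-adjoint means $\langle Ax,y\rangle=\langle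 x,Ay\rangle$ for all $x,y$. *)

(* Defs.v *)
From Stdlib Require Import Reals Lra List ClassicalEpsilon.
Open Scope R_scope.

(** Vectors are functions nat -> R; a point of R^m only uses coordinates < m. *)
Definition vec := nat -> R.

Fixpoint sumR (m : nat) (f : nat -> R) : R :=
  match m with O => 0 | S m' => sumR m' f + f m' end.

Definition inner (c : R) (n : nat) (u v : vec) : R :=
  - (u 0%nat * v 0%nat) + c * (u 1%nat * v 1%nat)
  + sumR n (fun i => u (i + 2)%nat * v (i + 2)%nat).

Definition in_Rn (n : nat) (p : vec) : Prop := forall i, (n <= i)%nat -> p i = 0.

Definition openR (n : nat) (W : vec -> Prop) : Prop :=
  forall p, W p -> in_Rn n p /\
    exists d, 0 < d /\ forall q, in_Rn n q ->
      (forall i, (i < n)%nat -> Rabs (q i - p i) < d) -> W q.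

Definition shift (p : vec) (i : nat) (t : R) : vec :=
  fun j => if Nat.eqb j i then p j + t else p j.

Definition has_pd (i : nat) (f : vec -> R) (p : vec) (l : R) : Prop :=
  derivable_pt_lim (fun t => f (shift p i t)) 0 l.

Definition pd (i : nat) (f : vec -> R) (p : vec) : R :=
  epsilon (inhabits 0) (has_pd i f p).

Fixpoint pds (l : list nat) (f : vec -> R) : vec -> R :=
  match l with nil => f | i :: l' => pd i (pds l' f) end.

Definition continuous_on (n : nat) (U : vec -> Prop) (f : vec -> R) : Prop :=
  forall p, U p -> forall e, 0 < e -> exists d, 0 < d /\
    forall q, U q -> (forall i, (i < n)%nat -> Rabs (q i - p i) < d) ->
      Rabs (f q - f p) < e.

Definition smooth_on (n : nat) (U : vec -> Prop) (f : vec -> R) : Prop :=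
  forall l : list nat, (forall i, In i l -> (i < n)%nat) ->
    continuous_on n U (pds l f) /\
    forall p, U p -> forall i, (i < n)%nat -> exists d, has_pd i (pds l f) p d.

Definition idm (i j : nat) : R := if Nat.eqb i j then 1 else 0.

Definition minor (i j : nat) (A : nat -> nat -> R) : nat -> nat -> R :=
  fun r s => A (if Nat.ltb r i then r else S r) (if Nat.ltb s j then s else S s).

Fixpoint det (m : nat) (A : nat -> nat -> R) : R :=
  match m with
  | O => 1
  | S m' => sumR m (fun j => (-1) ^ j * A 0%nat j * det m' (minor 0 j A))
  end.

Definition inv (m : nat) (A : nat -> nat -> R) : nat -> nat -> R :=
  fun i j => (-1) ^ (i + j) * det (m - 1) (minor j i A) / det m A.

Definition mmul (m : nat) (A B : nat -> nat -> R) : nat -> nat -> R :=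
  fun i j => sumR m (fun l => A i l * B l j).

Fixpoint mpow (m : nat) (A : nat -> nat -> R) (e : nat) : nat -> nat -> R :=
  match e with O => idm | S e' => mmul m A (mpow m A e') end.

Definition charcoeffs (m : nat) (S : nat -> nat -> R) (a : nat -> R) : Prop :=
  forall t, det m (fun i j => t * idm i j - S i j)
            = sumR (m + 1) (fun j => a j * t ^ (m - j)).

Definition charcoef (m : nat) (S : nat -> nat -> R) : nat -> R :=
  epsilon (inhabits (fun _ => 0)) (charcoeffs m S).

(** ---------- local geometry of a hypersurface in a chart ----------
   X : R^n -> R^{n+2}  is psi composed with a chart, Nf the unit normal
   composed with the chart. *)
Definition dv (i : nat) (F : vec -> vec) (p : vec) : vec :=
  fun r => pd i (fun q => F q r) p.

Definition metric (n : nat) (c : R) (X : vec -> vec) (p : vec) (i j : nat) : R :=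
  inner c n (dv i X p) (dv j X p).

Definition ginv (n : nat) (c : R) (X : vec -> vec) (p : vec) : nat -> nat -> R :=
  inv n (metric n c X p).

Definition christ (n : nat) (c : R) (X : vec -> vec) (p : vec) (m i j : nat) : R :=
  / 2 * sumR n (fun l => ginv n c X p m l *
      (pd i (fun q => metric n c X q j l) p + pd j (fun q => metric n c X q i l) p
       - pd l (fun q => metric n c X q i j) p)).

(** matrix (nabla^2 f)^l_i of the endomorphism  Y |-> nabla_Y grad f *)
Definition hessE (n : nat) (c : R) (X : vec -> vec) (f : vec -> R) (p : vec)
  (l i : nat) : R :=
  sumR n (fun j => ginv n c X p l j *
     (pd i (pd j f) p - sumR n (fun m => christ n c X p m i j * pd m f p))).

(** second fundamental form <S d_i, d_j> = - <d_i N, d_j X> and the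
    matrix S^l_i of the shape operator S = - nabla^0 N *)
Definition sff (n : nat) (c : R) (X Nf : vec -> vec) (p : vec) (i j : nat) : R :=
  - inner c n (dv i Nf p) (dv j X p).

Definition shapeM (n : nat) (c : R) (X Nf : vec -> vec) (p : vec) : nat -> nat -> R :=
  fun l i => sumR n (fun j => ginv n c X p l j * sff n c X Nf p i j).

Definition acoef (n : nat) (c : R) (X Nf : vec -> vec) (p : vec) (j : nat) : R :=
  charcoef n (shapeM n c X Nf p) j.

Definition newtonP (n : nat) (c : R) (X Nf : vec -> vec) (k : nat) (p : vec)
  : nat -> nat -> R :=
  fun i l => sumR (k + 1) (fun j =>
     acoef n c X Nf p (k - j) * mpow n (shapeM n c X Nf p) j i l).

Definition Lk (n : nat) (c : R) (X Nf : vec -> vec) (k : nat) (f : vec -> R)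
  (p : vec) : R :=
  sumR n (fun i => sumR n (fun l => newtonP n c X Nf k p i l * hessE n c X f p l i)).

(** ---------- the manifold M and the hypersurface ----------
   M is given by an atlas of charts x a : U a -> M, U a open in R^n. *)
Definition Mopen {M I : Type} (n : nat) (U : I -> vec -> Prop) (x : I -> vec -> M)
  (V : M -> Prop) : Prop :=
  forall a, openR n (fun p => U a p /\ V (x a p)).

Definition is_atlas {M I : Type} (n : nat) (U : I -> vec -> Prop) (x : I -> vec -> M)
  : Prop :=
  (forall a, openR n (U a)) /\
  (forall a p q, U a p -> U a q -> x a p = x a q -> p = q) /\
  (forall m : M, exists a p, U a p /\ x a p = m) /\
  (* charts are open maps (homeomorphisms onto open subsets) *)
  (forall a (W : vec -> Prop), openR n W -> (forall p, W p -> U a p) ->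
     Mopen n U x (fun m => exists p, W p /\ x a p = m)).

Definition Hausdorff_M {M I : Type} (n : nat) (U : I -> vec -> Prop) (x : I -> vec -> M)
  : Prop :=
  forall m1 m2 : M, m1 <> m2 -> exists V1 V2, Mopen n U x V1 /\ Mopen n U x V2 /\
    V1 m1 /\ V2 m2 /\ forall m, ~ (V1 m /\ V2 m).

Definition connected_M {M I : Type} (n : nat) (U : I -> vec -> Prop) (x : I -> vec -> M)
  : Prop :=
  forall V : M -> Prop, Mopen n U x V -> Mopen n U x (fun m => ~ V m) ->
    (forall m, V m) \/ (forall m, ~ V m).

Definition hypersurface (n : nat) (c eps : R) {M I : Type}
  (U : I -> vec -> Prop) (x : I -> vec -> M) (psi N : M -> vec) : Prop :=
  is_atlas n U x /\ Hausdorff_M n U x /\ connected_M n U x /\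
  (forall m, inner c n (psi m) (psi m) = c) /\
  (forall m, inner c n (N m) (N m) = eps) /\
  (forall m, inner c n (N m) (psi m) = 0) /\
  (forall a r, (r < n + 2)%nat ->
      smooth_on n (U a) (fun q => psi (x a q) r) /\
      smooth_on n (U a) (fun q => N (x a q) r)) /\
  (forall a p, U a p -> forall i, (i < n)%nat ->
      inner c n (N (x a p)) (dv i (fun q => psi (x a q)) p) = 0) /\
  (forall a p, U a p -> det n (metric n c (fun q => psi (x a q)) p) <> 0).

Definition Hk_constant (n : nat) (c eps : R) (k : nat) {M I : Type}
  (U : I -> vec -> Prop) (x : I -> vec -> M) (psi N : M -> vec) : Prop :=
  exists H : R, forall a p, U a p ->
    C n k * H = (- eps) ^ k * acoef n c (fun q => psi (x a q)) (fun q => N (x a q)) p k.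

Definition self_adjoint (n : nat) (c : R) (A : nat -> nat -> R) : Prop :=
  forall u v : vec,
    inner c n (fun r => sumR (n + 2) (fun s => A r s * u s)) v
    = inner c n u (fun r => sumR (n + 2) (fun s => A r s * v s)).

Definition nonzero_vec (n : nat) (b : vec) : Prop := exists r, (r < n + 2)%nat /\ b r <> 0.

Definition Lk_affine (n : nat) (c : R) (k : nat) {M I : Type}
  (U : I -> vec -> Prop) (x : I -> vec -> M) (psi N : M -> vec)
  (A : nat -> nat -> R) (b : vec) : Prop :=
  forall a p, U a p -> forall r, (r < n + 2)%nat ->
    Lk n c (fun q => psi (x a q)) (fun q => N (x a q)) k (fun q => psi (x a q) r) p
    = sumR (n + 2) (fun s => A r s * psi (x a p) s) + b r.

Definition in_umbilic (n : nat) (c : R) {M : Type} (psi : M -> vec) (a : vec) (tau : R)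
  : Prop :=
  nonzero_vec n a /\ tau <> 0 /\ inner c n a a - c * tau ^ 2 <> 0 /\
  forall m, inner c n a (psi m) = tau.

(** intrinsic types: the section is  (tau/<a,a>) a + { y in a^perp : <y,y> = c - tau^2/<a,a> } *)
Definition case_i (n : nat) {M : Type} (psi : M -> vec) : Prop :=
  exists a tau, in_umbilic n 1 psi a tau /\
   let aa := inner 1 n a a in
   ( (* S^n(r), r > 1 *)
     (exists r, 1 < r /\ aa < 0 /\ r ^ 2 = 1 - tau ^ 2 / aa)
   \/ (* H^n(-r), r > 0 *)
     (exists r, 0 < r /\ 0 < aa /\ - r ^ 2 = 1 - tau ^ 2 / aa)
   \/ (* S^n_1(r), 0 < r < 1 *)
     (exists r, 0 < r /\ r < 1 /\ 0 < aa /\ r ^ 2 = 1 - tau ^ 2 / aa)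
   \/ (* R^n *)
     aa = 0 ).

Definition case_ii (n : nat) {M : Type} (psi : M -> vec) : Prop :=
  exists a tau, in_umbilic n (-1) psi a tau /\
   let aa := inner (-1) n a a in
   ( (* H^n_1(-r), r > 1 *)
     (exists r, 1 < r /\ 0 < aa /\ - r ^ 2 = -1 - tau ^ 2 / aa)
   \/ (* H^n(-r), 0 < r < 1 *)
     (exists r, 0 < r /\ r < 1 /\ aa < 0 /\ - r ^ 2 = -1 - tau ^ 2 / aa)
   \/ (* S^n_1(r), r > 0 *)
     (exists r, 0 < r /\ aa < 0 /\ r ^ 2 = -1 - tau ^ 2 / aa)
   \/ (* R^n_1 *)
     aa = 0 ).

(* Main.v *)
(** With [h] the second fundamental form, the Gauss formula
    [d_i d_j psi = Gamma d psi + eps h_ij N - c g_ij psi] gives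
    [L_k psi = eps tr(P_k S) N - c tr(P_k) psi], and [tr P_k = (n - k) a_k] is constant when
    [H_k] is.  If [L_k psi = A psi + b] with [A] self-adjoint, then [<A psi + b, psi>] is
    constant; differentiating it shows that [b] is orthogonal to every tangent vector, so
    [<b, psi>] is locally constant and [M] lies in a hyperplane with normal [b]; since [b] is
    nonzero, this section is neither degenerate nor totally geodesic.  Conversely, on a section
    [<a, psi> = tau] one has [a = eps nu N + c tau psi] with [nu] a nonzero constant, so [N] is
    an affine function of [psi] and [S] is a nonzero multiple of the identity, whence
    [a_k <> 0]. *)

(* The coefficient $\operatorname{tr}(P_kS)=-(k+1)a_{k+1}$ of $N$ may vary over $M$; the
   orthogonality of $b$ to $M$ therefore rests only on pairings with $\psi$ and with tangent
   vectors, where $N$ drops out. Vector identities in $\mathbb{R}^{n+2}$ are tested against the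
   frame $\partial_i\psi, N, \psi$, whose Gram matrix is block diagonal with invertible blocks. The
   formula for $\operatorname{tr}P_k$ reflects that the trace of the adjugate of $X-S$ is the
   derivative of the characteristic polynomial. Since [pd] and [charcoef] are chosen by [epsilon],
   their values are always reached through existence together with uniqueness. *)
From mathcomp Require all_boot all_algebra Rstruct.
From Coquelicot Require Derive_2d.
Require Import Defs.
From Stdlib Require Import Reals Lra Lia ClassicalEpsilon FunctionalExtensionality.
Open Scope R_scope.

(** * Adjugate, derivative of the characteristic polynomial and Newton transformations *)

Section CharacteristicPolynomial.
Import all_boot all_algebra.
Import GRing.Theory.
Local Open Scope ring_scope.

Lemma deriv_big_prod (F : comNzRingType) (I : eqType) (r : seq I) (u : I -> {poly F}) :
  uniq r ->
  (\prod_(i <- r) u i)^`() = \sum_(i <- r) (u i)^`() * \prod_(j <- r | j != i) u j.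
Proof.
elim: r => [|x r IH] /=; first by rewrite !big_nil -[1]/(1%:P) derivC.
move=> /andP[xr ur]; rewrite !big_cons derivM IH // eqxx /=; congr (_ + _).
  congr (_ * _); rewrite [RHS]big_seq_cond [LHS]big_seq_cond; apply: eq_bigl => j.
  by rewrite andbT; case jr: (j \in r) => //=; apply/esym; apply: contraNneq xr => <-.
rewrite mulr_sumr [LHS]big_seq [RHS]big_seq; apply: eq_bigr => i ir.
have -> : \prod_(j <- x :: r | j != i) u j = u x * \prod_(j <- r | j != i) u j.
  by rewrite big_cons ifT //; apply: contraNneq xr => ->.
by rewrite mulrCA.
Qed.

Lemma deriv_det (F : comNzRingType) n (M : 'M[{poly F}]_n) :
  (\det M)^`() = \sum_i \sum_j (M i j)^`() * cofactor M i j.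
Proof.
(* [D i] is [M] with row [i] differentiated. Cofactors along row [i] ignore that row, so expanding
   along it gives the inner sum. *)
pose D i : 'M[{poly F}]_n := \matrix_(k, j) if k == i then (M i j)^`() else M k j.
have cofD i j : cofactor (D i) i j = cofactor M i j.
  rewrite /cofactor; congr (_ * \det _); apply/matrixP=> k l.
  by rewrite !mxE eq_sym (negPf (neq_lift _ _)).
transitivity (\sum_i \det (D i)); last first.
  apply: eq_bigr => i _; rewrite (expand_det_row _ i); apply: eq_bigr => j _.
  by rewrite cofD mxE eqxx.
rewrite exchange_big (raddf_sum (@deriv F)); apply: eq_bigr => s _ /=.
have sgn0 : ((-1) ^+ perm.odd_perm s : {poly F})^`() = 0.
  by case: (perm.odd_perm s); rewrite ?expr1 ?expr0 ?derivN -polyC1 derivC ?oppr0.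
rewrite derivM sgn0 mul0r add0r deriv_big_prod ?index_enum_uniq //.
rewrite mulr_sumr; apply: eq_bigr => i _; congr (_ * _).
rewrite [RHS](bigD1 i) //= mxE eqxx; congr (_ * _).
by apply: eq_bigr => k ki; rewrite mxE (negPf ki).
Qed.

(** The entries of $X-A$ have derivative $\delta_{ij}$, so only the diagonal cofactors survive. *)
Lemma deriv_char_poly (F : comNzRingType) n (A : 'M[F]_n) :
  (char_poly A)^`() = \tr (\adj (char_poly_mx A)).
Proof.
rewrite deriv_det; apply: eq_bigr => i _; rewrite [RHS]mxE (bigD1 i) //= big1 ?addr0.
  by rewrite !mxE eqxx derivB derivX derivC subr0 mul1r.
by move=> j ji; rewrite !mxE eq_sym (negPf ji) derivB derivC mulr0n deriv0 subr0 mul0r.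
Qed.

(* The coefficients [B j] of the adjugate of [X - A] satisfy
   [B j = p_(j+1) + A * B (j+1)], so they are the Newton transformations of [A]. *)
Lemma trace_newton (F : comNzRingType) n (A : 'M[F]_n) k : (k < n)%N ->
  \sum_(j < k.+1) (char_poly A)`_(n - (k - j)) * \tr (A ^+ j) =
  (char_poly A)`_(n - k) *+ (n - k).
Proof.
pose p := char_poly A; pose B j : 'M[F]_n := \matrix_(u, v) (\adj (char_poly_mx A) u v)`_j.
have Brec j : B j = (p`_j.+1)%:M + A *m B j.+1.
  have := mul_mx_adj (char_poly_mx A); rewrite -/p => E.
  apply/matrixP=> u v; move/matrixP: E => /(_ u v).
  rewrite mulmxBl mul_scalar_mx => E.
  have {E}: (('X *: \adj (char_poly_mx A) - map_mx polyC A *m \adj (char_poly_mx A)) u v)`_j.+1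
     = ((\det (char_poly_mx A))%:M u v)`_j.+1 by rewrite E.
  rewrite !mxE coefB coefXM /= coef_sum coefMn => E.
  rewrite -E -[LHS](subrK (\sum_w (map_mx polyC A u w * \adj (char_poly_mx A) w v)`_j.+1)).
  by congr (_ + _); apply: eq_bigr => w _; rewrite !mxE coefCM.
(* The recursion runs downwards and needs a start: beyond the sizes of all entries every coefficient
   vanishes. *)
have Bbig : exists L, forall j, (L <= j)%N -> B j = 0.
  exists (\max_u \max_v size (\adj (char_poly_mx A) u v)) => j Lj.
  apply/matrixP=> u v; rewrite [LHS]mxE [RHS]mxE nth_default //; apply: leq_trans Lj.
  pose sz u v := size (\adj (char_poly_mx A) u v).
  apply: (@leq_trans (\max_v sz u v)).
    exact: (@leq_bigmax _ (sz u)).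
  exact: (@leq_bigmax _ (fun u => \max_v sz u v)).
(* From index [n] on, $p_{j+1}=0$, so the recursion carries the vanishing down from [L] to [n]. *)
have Bn j : (n <= j)%N -> B j = 0.
  case: Bbig => L BL; have [d Ld] : exists d, (L <= j + d)%N by exists L; rewrite leq_addl.
  elim: d j Ld => [|d IH] j Ld nj; first by apply: BL; rewrite addn0 in Ld.
  rewrite Brec IH ?mulmx0 ?addSnnS // ?(leq_trans nj) // nth_default ?addr0; last first.
    by rewrite size_char_poly.
  by apply/matrixP=> u v; rewrite !mxE mul0rn.
(* The Newton transformation $P_m$ sits at index $n-m-1$, since the adjugate has degree $n-1$. *)
have Bsum m : (m < n)%N ->
    B (n - m.+1)%N = \sum_(j < m.+1) p`_(n - (m - j)) *: A ^+ j.
  elim: m => [|m IH] mn.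
    rewrite Brec subn1 prednK // Bn // mulmx0 addr0 big_ord1 subn0.
    by rewrite expr0 scalemx1.
  rewrite Brec -subSn // subSS IH; last by apply: ltnW.
  rewrite [RHS]big_ord_recl subn0 expr0 scalemx1; congr (_ + _).
  rewrite mulmx_sumr; apply: eq_bigr => j _.
  by rewrite lift0 subSS -scalemxAr exprS.
(* Coefficient $n-k-1$ of $p'$ is $(n-k)p_{n-k}$, which is where the factor $n-k$ comes from. *)
move=> kn; have : \tr (B (n - k.+1)%N) = (p^`())`_(n - k.+1).
  rewrite deriv_char_poly [in RHS]/mxtrace coef_sum.
  by apply: eq_bigr => i _; rewrite mxE.
rewrite coef_deriv -subSn // subSS => <-; rewrite Bsum // raddf_sum.
by apply: eq_bigr => j _; rewrite /= mxtraceZ.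
Qed.

Lemma char_poly_scalar (F : comNzRingType) n (a : F) :
  char_poly (a%:M : 'M[F]_n) = ('X - a%:P) ^+ n.
Proof.
rewrite char_poly_trig ?scalar_mx_is_trig //.
by under eq_bigr do rewrite mxE eqxx mulr1n; rewrite prodr_const card_ord.
Qed.

Lemma left_kernel_right_kernel (F : fieldType) m (E : 'M[F]_m) :
  (forall x : 'rV_m, x *m E = 0 -> x = 0) ->
  forall w : 'cV_m, E *m w = 0 -> w = 0.
Proof.
move=> inj w Ew; have : row_free E.
  by apply: inj_row_free => x /inj.
rewrite row_free_unit => uE; by rewrite -(mulKmx uE w) Ew mulmx0.
Qed.

End CharacteristicPolynomial.

(** * Passage from matrices given as functions on indices to matrices of fixed size *)

Section MatrixTranslation.
Import all_boot all_algebra Rstruct.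
Import GRing.Theory Num.Theory.

Definition mx m (A : nat -> nat -> R) : 'M[R]_m := (\matrix_(i, j) A i j)%R.

Lemma sumR_big m (f : nat -> R) : sumR m f = (\sum_(i < m) f i)%R.
Proof. by elim: m => [|m IH] /=; rewrite ?big_ord0 // big_ord_recr /= IH. Qed.

Lemma minor_mx m A (i j : 'I_m.+1) : mx m (minor i j A) = row' i (col' j (mx m.+1 A)).
Proof.
have bumpE (h k : nat) : (if Nat.ltb k h then k else S k) = bump h k.
  rewrite /bump leqNgt; case: Nat.ltb_spec0 => [/ltP-> //|H].
  by have -> : (k < h)%N = false by apply/negP => /ltP.
by apply/matrixP=> r s; rewrite !mxE /minor !bumpE.
Qed.

Lemma det_mx m A : det m A = (\det (mx m A))%R.
Proof.
elim: m A => [|m IH] A; first by rewrite det_mx00.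
have -> : det m.+1 A = sumR m.+1 (fun j => (-1) ^ j * A 0%N j * det m (minor 0 j A)) by [].
rewrite sumR_big (expand_det_row _ ord0); apply: eq_bigr => j _.
by rewrite IH (minor_mx _ _ ord0 j) [in RHS]mxE /cofactor add0n RpowE mulrCA mulrA.
Qed.

Lemma idm_mx m (i j : 'I_m) : idm i j = (1%:M : 'M[R]_m)%R i j.
Proof.
rewrite mxE /idm; case: (Nat.eqb_spec i j) => [/val_inj->|ne]; first by rewrite eqxx.
by case: eqP => [ij|//]; case: ne; rewrite ij.
Qed.

Lemma inv_mx m A : det m A <> 0 -> mx m (Defs.inv m A) = invmx (mx m A).
Proof.
(* In size 0 the index [m - 1] truncates, but there is no entry to compare. *)
case: m => [|m] dA; first by apply/matrixP=> -[].
have uA : mx m.+1 A \in unitmx by rewrite unitmxE unitfE -det_mx; apply/eqP.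
apply/matrixP=> i j; rewrite /invmx uA !mxE -det_mx.
have -> : Defs.inv m.+1 A i j =
  (-1) ^ (i + j)%N * det (m.+1 - 1)%N (minor j i A) / det m.+1 A by [].
by rewrite subn1 (det_mx m) minor_mx /cofactor RpowE RdivE mulrC addnC.
Qed.

Lemma mul_inv_r m A (i j : nat) : det m A <> 0 -> (i < m)%coq_nat -> (j < m)%coq_nat ->
  sumR m (fun l => A i l * Defs.inv m A l j) = idm i j.
Proof.
move=> dA /ltP im /ltP jm.
have uA : mx m A \in unitmx by rewrite unitmxE unitfE -det_mx; apply/eqP.
have /matrixP/(_ (Ordinal im) (Ordinal jm)) := mulmxV uA.
rewrite -idm_mx -inv_mx // mxE sumR_big /= => <-.
by apply: eq_bigr => l _; rewrite !mxE.
Qed.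

Lemma mul_inv_l m A (i j : nat) : det m A <> 0 -> (i < m)%coq_nat -> (j < m)%coq_nat ->
  sumR m (fun l => Defs.inv m A i l * A l j) = idm i j.
Proof.
move=> dA /ltP im /ltP jm.
have uA : mx m A \in unitmx by rewrite unitmxE unitfE -det_mx; apply/eqP.
have /matrixP/(_ (Ordinal im) (Ordinal jm)) := mulVmx uA.
rewrite -idm_mx -inv_mx // mxE sumR_big /= => <-.
by apply: eq_bigr => l _; rewrite !mxE.
Qed.

Lemma mpow_mx m A e : mx m (mpow m A e) = (mx m A ^+ e)%R.
Proof.
elim: e => [|e IH]; first by apply/matrixP=> i j; rewrite mxE /= idm_mx expr0.
rewrite exprS -IH; apply/matrixP=> i j; rewrite !mxE /= /mmul sumR_big.
by apply: eq_bigr => l _; rewrite !mxE.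
Qed.

(** Evaluation at [t] is a ring morphism, so it commutes with the determinant. The reindexing
    reverses the order, since [charcoeffs] counts from the leading term. *)
Lemma charcoeffs_char_poly m A : charcoeffs m A (fun j => (char_poly (mx m A))`_(m - j))%R.
Proof.
move=> t; rewrite det_mx sumR_big Nat.add_1_r.
have -> : mx m (fun i j => t * idm i j - A i j) = map_mx (horner_eval t) (char_poly_mx (mx m A)).
  apply/matrixP=> i j; rewrite !mxE idm_mx !mxE /horner_eval.
  rewrite hornerD hornerN hornerC hornerMn hornerX.
  by rewrite RminusE RmultE mulr_natr.
rewrite det_map_mx /= /horner_eval -/(char_poly _) (@horner_coef_wide _ m.+1) ?size_char_poly //.
rewrite (reindex_inj rev_ord_inj) /=; apply: eq_bigr => j _.
by rewrite RpowE subSS.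
Qed.

Lemma charcoeffs_inj m A a b j : charcoeffs m A a -> charcoeffs m A b ->
  (j <= m)%coq_nat -> a j = b j.
Proof.
move=> Ha Hb /leP jm.
pose P (u : nat -> R) := (\poly_(i < m.+1) u (m - i)%N)%R.
have PE u t : (P u).[t]%R = sumR (m + 1)%coq_nat (fun j => u j * t ^ (m - j)%coq_nat).
  rewrite horner_poly sumR_big Nat.add_1_r (reindex_inj rev_ord_inj) /=; apply: eq_bigr => i _.
  by rewrite RpowE subSS subKn // -ltnS.
have D0 : (P a - P b = 0)%R.
  apply/eqP; apply: contraT => nz.
  (* The naturals below the size of the difference are one root too many for a nonzero
     polynomial. *)
  have := @max_poly_roots _ (P a - P b)%R [seq i%:R%R | i <- iota 0 (size (P a - P b)%R)] nz.
  rewrite size_map size_iota ltnn => H; apply: contraTT isT => _; apply: H.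
    apply/allP=> _ /mapP[i _ ->]; rewrite rootE hornerD hornerN !PE -Ha -Hb.
    by rewrite subrr.
  rewrite map_inj_uniq ?iota_uniq // => x y /eqP; rewrite eqr_nat; exact/eqP.
have : ((P a)`_(m - j) = (P b)`_(m - j))%R by move/subr0_eq: D0 => ->.
by rewrite !coef_poly !ltnS leq_subr subKn.
Qed.

(** [epsilon] selects some sequence, and the defining identity determines it only up to index [m];
    hence the bound on [j]. *)
Lemma charcoef_char_poly m A j : (j <= m)%coq_nat ->
  charcoef m A j = ((char_poly (mx m A))`_(m - j))%R.
Proof.
move=> jm; apply: (@charcoeffs_inj m A _ (fun j => (char_poly (mx m A))`_(m - j))%R) => //.
  exact: (epsilon_spec (inhabits (fun=> 0)) _ (ex_intro _ _ (charcoeffs_char_poly m A))).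
exact: charcoeffs_char_poly.
Qed.

Lemma trace_newton_transform m A k : (k < m)%coq_nat ->
  sumR m (fun i => sumR (k + 1)%coq_nat (fun j =>
    charcoef m A (k - j)%coq_nat * mpow m A j i i)) = INR (m - k)%coq_nat * charcoef m A k.
Proof.
move=> /ltP km; have km' := ltnW km.
rewrite charcoef_char_poly; last exact/leP.
rewrite INRE RmultE mulr_natl -trace_newton // sumR_big Nat.add_1_r.
under eq_bigr do rewrite sumR_big.
rewrite exchange_big /=; apply: eq_bigr => j _; rewrite -mpow_mx /mxtrace.
rewrite mulr_sumr; apply: eq_bigr => i _; rewrite mxE charcoef_char_poly //.
by apply/leP; apply: leq_trans km'; rewrite leq_subr.
Qed.

(** The coefficient is $\binom{m}{k}(-\lambda)^k$, from the binomial expansion of $(X-\lambda)^m$.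
    This is what makes [b] nonzero in the converse. *)
Lemma charcoef_scalar_neq0 m A lam k : (k <= m)%coq_nat -> lam <> 0 ->
  (forall i j, (i < m)%coq_nat -> (j < m)%coq_nat -> A i j = lam * idm i j) ->
  charcoef m A k <> 0.
Proof.
move=> km l0 AE; rewrite charcoef_char_poly //.
have -> : mx m A = (lam%:M)%R.
  apply/matrixP=> i j; rewrite mxE AE; try exact/ltP.
  by rewrite idm_mx !mxE RmultE mulr_natr.
rewrite char_poly_scalar -polyCN exprDn coef_sum.
have km' : (k < m.+1)%N by rewrite ltnS; apply/leP.
have coefE (i : 'I_m.+1) : (('X ^+ (m - i) * (- lam)%:P ^+ i *+ 'C(m, i))`_(m - k)
    = if i == Ordinal km' then (- lam) ^+ i *+ 'C(m, i) else 0)%R.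
  rewrite -polyC_exp coefMn coefMC coefXn.
  have -> : (m - k == m - i)%N = (i == Ordinal km').
    apply/eqP/eqP => [H|-> //]; apply: val_inj => /=.
    by rewrite -[k](@subKn _ m) ?H ?subKn // -ltnS.
  by case: eqP => _; rewrite ?mul1r // mul0r mul0rn.
under eq_bigr do rewrite coefE.
rewrite -big_mkcond big_pred1_eq /=; apply/eqP.
by rewrite -mulr_natr mulf_neq0 ?expf_neq0 ?oppr_eq0 ?pnatr_eq0 -?lt0n ?bin_gt0 //; apply/eqP.
Qed.

Lemma right_kernel_trivial m (E : nat -> nat -> R) (w : nat -> R) :
  (forall y : nat -> R, (forall r, (r < m)%coq_nat -> sumR m (fun i => y i * E i r) = 0) ->
     forall i, (i < m)%coq_nat -> y i = 0) ->
  (forall i, (i < m)%coq_nat -> sumR m (fun r => E i r * w r) = 0) ->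
  forall r, (r < m)%coq_nat -> w r = 0.
Proof.
move=> inj Ew r rm; pose wc : 'cV[R]_m := (\col_i w i)%R.
suff /matrixP/(_ (Ordinal (introT ltP rm)) ord0) : wc = 0%R by rewrite !mxE.
apply: (@left_kernel_right_kernel _ _ (mx m E)); last first.
  apply/matrixP=> i u; rewrite !mxE -[RHS](Ew i); last exact/ltP.
  by rewrite sumR_big; apply: eq_bigr => s _; rewrite !mxE.
move=> y yE; apply/rowP=> i; rewrite !mxE.
(* Extension by zero of the row vector to all indices, so that [inj] applies to it. *)
pose y' (i : nat) := if insub i is Some o then y ord0 o else 0.
have y'E (o : 'I_m) : y' o = y ord0 o by rewrite /y' valK.
rewrite -y'E; apply: inj; last exact/ltP.
move=> s /ltP sm; have /rowP/(_ (Ordinal sm)) := yE; rewrite !mxE => E0.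
by rewrite -[RHS]E0 sumR_big; apply: eq_bigr => o _; rewrite !mxE y'E.
Qed.

End MatrixTranslation.

(** * Finite sums and the indefinite inner product *)

Lemma sumR_ext m (f g : nat -> R) :
  (forall i, (i < m)%nat -> f i = g i) -> sumR m f = sumR m g.
Proof.
  induction m as [|m IH]; intros H; simpl; [reflexivity|].
  rewrite IH by (intros; apply H; lia). rewrite H by lia. reflexivity.
Qed.

Lemma sumR_0 m (f : nat -> R) : (forall i, (i < m)%nat -> f i = 0) -> sumR m f = 0.
Proof.
  induction m as [|m IH]; intros H; simpl; [reflexivity|].
  rewrite IH by (intros; apply H; lia). rewrite H by lia. ring.
Qed.

Lemma sumR_plus m (f g : nat -> R) : sumR m (fun i => f i + g i) = sumR m f + sumR m g.
Proof. induction m as [|m IH]; simpl; [ring|]. rewrite IH. ring. Qed.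

Lemma sumR_scal m a (f : nat -> R) : sumR m (fun i => a * f i) = a * sumR m f.
Proof. induction m as [|m IH]; simpl; [ring|]. rewrite IH. ring. Qed.

Lemma sumR_swap m m' (f : nat -> nat -> R) :
  sumR m (fun i => sumR m' (fun j => f i j)) = sumR m' (fun j => sumR m (fun i => f i j)).
Proof.
  induction m as [|m IH]; simpl; [symmetry; apply sumR_0; reflexivity|].
  rewrite IH, <- sumR_plus. reflexivity.
Qed.

Lemma sumR_head m (f : nat -> R) : sumR (S m) f = f 0%nat + sumR m (fun i => f (S i)).
Proof. induction m as [|m IH]; simpl in *; [ring|]. rewrite IH. ring. Qed.

Lemma idm_same i : idm i i = 1.
Proof. unfold idm. rewrite Nat.eqb_refl. reflexivity. Qed.

Lemma idm_diff i j : i <> j -> idm i j = 0.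
Proof. intros H. unfold idm. apply Nat.eqb_neq in H. rewrite H. reflexivity. Qed.

Lemma sumR_idm m (f : nat -> R) j : (j < m)%nat -> sumR m (fun i => f i * idm i j) = f j.
Proof.
  induction m as [|m IH]; intros H; [lia|]. simpl.
  destruct (Nat.eq_dec j m) as [->|ne].
  - rewrite idm_same, sumR_0; [ring|].
    intros i Hi. rewrite idm_diff by lia. ring.
  - rewrite IH, idm_diff by lia. ring.
Qed.

(** The diagonal of the metric; it turns [inner] into a single sum over all [n + 2] coordinates. *)
Definition eta (c : R) (r : nat) : R :=
  match r with O => -1 | S O => c | _ => 1 end.

Lemma inner_eta c n u v : inner c n u v = sumR (n + 2) (fun r => eta c r * u r * v r).
Proof.
  unfold inner. replace (n + 2)%nat with (S (S n)) by lia.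
  rewrite !sumR_head. simpl.
  rewrite (sumR_ext n (fun i => 1 * u (S (S i)) * v (S (S i)))
             (fun i => u (i + 2)%nat * v (i + 2)%nat)); [ring|].
  intros i _. replace (i + 2)%nat with (S (S i)) by lia. ring.
Qed.

Lemma inner_ext c n u u' v v' :
  (forall r, (r < n + 2)%nat -> u r = u' r) -> (forall r, (r < n + 2)%nat -> v r = v' r) ->
  inner c n u v = inner c n u' v'.
Proof.
  intros H H'. rewrite !inner_eta. apply sumR_ext. intros r Hr. rewrite H, H' by assumption.
  reflexivity.
Qed.

Lemma inner_sym c n u v : inner c n u v = inner c n v u.
Proof. rewrite !inner_eta. apply sumR_ext. intros. ring. Qed.

Lemma inner_0_l c n u v : (forall r, (r < n + 2)%nat -> u r = 0) -> inner c n u v = 0.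
Proof. intros H. rewrite inner_eta. apply sumR_0. intros. rewrite H by assumption. ring. Qed.

Lemma inner_plus_l c n u u' v :
  inner c n (fun r => u r + u' r) v = inner c n u v + inner c n u' v.
Proof. rewrite !inner_eta, <- sumR_plus. apply sumR_ext. intros. ring. Qed.

Lemma inner_scal_l c n a u v : inner c n (fun r => a * u r) v = a * inner c n u v.
Proof. rewrite !inner_eta, <- sumR_scal. apply sumR_ext. intros. ring. Qed.

Lemma inner_lincomb_l c n m (y : nat -> R) (F : nat -> vec) v :
  inner c n (fun r => sumR m (fun i => y i * F i r)) v
  = sumR m (fun i => y i * inner c n (F i) v).
Proof.
  induction m as [|m IH]; simpl.
  - apply inner_0_l. reflexivity.
  - rewrite inner_plus_l, inner_scal_l, IH. reflexivity.
Qed.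

Lemma inner_comb3 c n a1 a2 a3 u1 u2 u3 v :
  inner c n (fun r => a1 * u1 r + a2 * u2 r + a3 * u3 r) v
  = a1 * inner c n u1 v + a2 * inner c n u2 v + a3 * inner c n u3 v.
Proof. rewrite !inner_plus_l, !inner_scal_l. reflexivity. Qed.

(** The Gram matrix of the [n + 2] vectors has the blocks $(\langle D_i,D_j\rangle)$, $\varepsilon$
    and $c$, all invertible. The vectors are thus independent, and nothing nonzero is orthogonal to
    all of them. *)
Lemma frame_complete n c eps (D : nat -> vec) (Nv Pv w : vec) :
  c <> 0 -> eps <> 0 -> det n (fun i j => inner c n (D i) (D j)) <> 0 ->
  (forall i, (i < n)%nat -> inner c n (D i) Nv = 0) ->
  (forall i, (i < n)%nat -> inner c n (D i) Pv = 0) ->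
  inner c n Nv Pv = 0 -> inner c n Nv Nv = eps -> inner c n Pv Pv = c ->
  (forall i, (i < n)%nat -> inner c n (D i) w = 0) ->
  inner c n Nv w = 0 -> inner c n Pv w = 0 ->
  forall r, (r < n + 2)%nat -> w r = 0.
Proof.
  intros Hc He Hdet HDN HDP HNP HN HP HDw HNw HPw r Hr.
  pose (e := fun i => if Nat.ltb i n then D i else if Nat.eqb i n then Nv else Pv).
  assert (eD : forall i, (i < n)%nat -> e i = D i).
  { intros i Hi. unfold e. apply Nat.ltb_lt in Hi. rewrite Hi. reflexivity. }
  assert (eN : e n = Nv).
  { unfold e. rewrite Nat.ltb_irrefl, Nat.eqb_refl. reflexivity. }
  assert (eP : e (S n) = Pv).
  { unfold e. destruct (Nat.ltb_spec (S n) n); [lia|].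
    destruct (Nat.eqb_spec (S n) n); [lia|]. reflexivity. }
  (* [inner c n u w] is the plain dot product of [u] with [eta * w], so the square matrix with rows
     [e i] annihilates that vector. *)
  assert (Heta : eta c r * w r = 0).
  { apply (right_kernel_trivial (n + 2) e (fun r => eta c r * w r)); [| |assumption].
    - intros y Hy.
      assert (Z : forall v, sumR n (fun i => y i * inner c n (D i) v)
                  + y n * inner c n Nv v + y (S n) * inner c n Pv v = 0).
      { intros v. rewrite <- (inner_0_l c n _ v Hy), inner_lincomb_l.
        replace (n + 2)%nat with (S (S n)) by lia. simpl. rewrite eN, eP.
        f_equal. f_equal. apply sumR_ext. intros i Hi. rewrite eD by assumption. reflexivity. }
      assert (yN : y n = 0).
      { specialize (Z Nv). rewrite sumR_0 in Z
          by (intros i Hi; rewrite HDN by assumption; ring).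
        rewrite HN, (inner_sym c n Pv Nv), HNP in Z.
        apply (Rmult_eq_reg_r eps); [lra|assumption]. }
      assert (yP : y (S n) = 0).
      { specialize (Z Pv). rewrite sumR_0 in Z
          by (intros i Hi; rewrite HDP by assumption; ring).
        rewrite HP, HNP in Z. apply (Rmult_eq_reg_r c); [lra|assumption]. }
      (* With the last two coefficients gone, [Z (D j)] is a linear system in the Gram matrix,
         solved by its inverse. *)
      assert (yD : forall l, (l < n)%nat -> y l = 0).
      { intros l Hl. rewrite <- (sumR_idm n y l Hl).
        rewrite (sumR_ext n _ (fun i => sumR n (fun j =>
          inv n (fun i j => inner c n (D i) (D j)) j l * (y i * inner c n (D i) (D j))))).
        - rewrite sumR_swap. apply sumR_0. intros j Hj. rewrite sumR_scal.
          specialize (Z (D j)). rewrite yN, yP in Z.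
          replace (sumR n _) with 0 by lra. ring.
        - intros i Hi. rewrite <- (mul_inv_r n _ i l Hdet Hi Hl), <- sumR_scal.
          apply sumR_ext. intros. ring. }
      intros i Hi. destruct (Nat.eq_dec i n) as [->|]; [assumption|].
      destruct (Nat.eq_dec i (S n)) as [->|]; [assumption|]. apply yD. lia.
    - intros i Hi.
      transitivity (inner c n (e i) w).
      { rewrite inner_eta. apply sumR_ext. intros. ring. }
      destruct (Nat.eq_dec i n) as [->|]; [rewrite eN; assumption|].
      destruct (Nat.eq_dec i (S n)) as [->|]; [rewrite eP; assumption|].
      rewrite eD by lia. apply HDw. lia. }
  apply Rmult_integral in Heta. destruct Heta as [H|H]; [|assumption].
  exfalso. destruct r as [|[|r]]; simpl in H; [lra|apply Hc; assumption|lra].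
Qed.

(** * Partial derivatives along coordinate shifts *)

Lemma shift_0 p i : shift p i 0 = p.
Proof.
  apply functional_extensionality. intros j. unfold shift.
  destruct (Nat.eqb j i); ring.
Qed.

Lemma shift_shift p i s t : shift (shift p i s) i t = shift p i (s + t).
Proof.
  apply functional_extensionality. intros j. unfold shift.
  destruct (Nat.eqb j i); ring.
Qed.

Lemma shift_comm p i j s t : shift (shift p i s) j t = shift (shift p j t) i s.
Proof.
  apply functional_extensionality. intros l. unfold shift.
  destruct (Nat.eqb l i), (Nat.eqb l j); ring.
Qed.

Lemma shift_in_Rn n p i t : in_Rn n p -> (i < n)%nat -> in_Rn n (shift p i t).
Proof.
  intros Hp Hi j Hj. unfold shift. destruct (Nat.eqb_spec j i); [lia|]. apply Hp, Hj.
Qed.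

Lemma shift_dist p i t j : Rabs (shift p i t j - p j) <= Rabs t.
Proof.
  unfold shift. destruct (Nat.eqb j i).
  - right. f_equal. ring.
  - replace (p j - p j) with 0 by ring. rewrite Rabs_R0. apply Rabs_pos.
Qed.

Lemma openR_shift n U p i : openR n U -> U p -> (i < n)%nat ->
  exists d, 0 < d /\ forall t, Rabs t < d -> U (shift p i t).
Proof.
  intros HU Hp Hi. destruct (HU p Hp) as [Hpn [d [Hd H]]].
  exists d. split; [assumption|]. intros t Ht. apply H.
  - apply shift_in_Rn; assumption.
  - intros j _. apply Rle_lt_trans with (Rabs t); [apply shift_dist|assumption].
Qed.

Lemma derivable_pt_lim_local f g x l d : 0 < d ->
  (forall t, Rabs (t - x) < d -> f t = g t) ->
  derivable_pt_lim f x l -> derivable_pt_lim g x l.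
Proof.
  intros Hd Hfg Hf e He. destruct (Hf e He) as [[d' Hd'] H].
  assert (Hm : 0 < Rmin d d') by (apply Rmin_pos; assumption).
  exists (mkposreal _ Hm). simpl. intros h Hh Hhd.
  rewrite <- !Hfg.
  - apply H; [assumption|]. simpl.
    apply Rlt_le_trans with (Rmin d d'); [assumption|apply Rmin_r].
  - replace (x - x) with 0 by ring. rewrite Rabs_R0. assumption.
  - replace (x + h - x) with h by ring.
    apply Rlt_le_trans with (Rmin d d'); [assumption|apply Rmin_l].
Qed.

Lemma has_pd_unique i f p l l' : has_pd i f p l -> has_pd i f p l' -> l = l'.
Proof. apply uniqueness_limite. Qed.

Lemma has_pd_pd i f p l : has_pd i f p l -> has_pd i f p (pd i f p).
Proof. intros H. unfold pd. apply epsilon_spec. exists l. exact H. Qed.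

Lemma pd_eq i f p l : has_pd i f p l -> pd i f p = l.
Proof. intros H. apply (has_pd_unique i f p); [exact (has_pd_pd i f p l H)|exact H]. Qed.

Lemma has_pd_const i a p : has_pd i (fun _ => a) p 0.
Proof. apply (derivable_pt_lim_const a). Qed.

Lemma has_pd_plus i f g p l l' : has_pd i f p l -> has_pd i g p l' ->
  has_pd i (fun q => f q + g q) p (l + l').
Proof. intros H H'. exact (derivable_pt_lim_plus _ _ _ _ _ H H'). Qed.

Lemma has_pd_mult i f g p l l' : has_pd i f p l -> has_pd i g p l' ->
  has_pd i (fun q => f q * g q) p (l * g p + f p * l').
Proof.
  intros H H'. unfold has_pd.
  pose proof (derivable_pt_lim_mult _ _ _ _ _ H H') as HM.
  cbv beta in HM. rewrite shift_0 in HM. exact HM.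
Qed.

Lemma has_pd_scal i a f p l : has_pd i f p l -> has_pd i (fun q => a * f q) p (a * l).
Proof. intros H. exact (derivable_pt_lim_scal _ a _ _ H). Qed.

Lemma has_pd_sumR i m (f : nat -> vec -> R) p (l : nat -> R) :
  (forall r, (r < m)%nat -> has_pd i (f r) p (l r)) ->
  has_pd i (fun q => sumR m (fun r => f r q)) p (sumR m l).
Proof.
  induction m as [|m IH]; intros H; simpl; [apply has_pd_const|].
  apply has_pd_plus; [apply IH; intros|]; apply H; lia.
Qed.

Lemma has_pd_local n U i f g p l : openR n U -> U p -> (i < n)%nat ->
  (forall q, U q -> f q = g q) -> has_pd i f p l -> has_pd i g p l.
Proof.
  intros HU Hp Hi Hfg. destruct (openR_shift n U p i HU Hp Hi) as [d [Hd H]].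
  apply derivable_pt_lim_local with d; [assumption|].
  intros t Ht. apply Hfg, H. rewrite Rminus_0_r in Ht. assumption.
Qed.

Lemma has_pd_constant_on n U i f a p : openR n U -> U p -> (i < n)%nat ->
  (forall q, U q -> f q = a) -> has_pd i f p 0.
Proof.
  intros HU Hp Hi H. apply (has_pd_local n U i (fun _ => a)); try assumption.
  - intros q Hq. symmetry. apply H, Hq.
  - apply has_pd_const.
Qed.

Lemma has_pd_inner c n i (F G : vec -> vec) p (F' G' : vec) :
  (forall r, (r < n + 2)%nat -> has_pd i (fun q => F q r) p (F' r)) ->
  (forall r, (r < n + 2)%nat -> has_pd i (fun q => G q r) p (G' r)) ->
  has_pd i (fun q => inner c n (F q) (G q)) p (inner c n F' (G p) + inner c n (F p) G').
Proof.
  intros HF HG.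
  replace (fun q => inner c n (F q) (G q))
    with (fun q => sumR (n + 2) (fun r => eta c r * (F q r * G q r)))
    by (apply functional_extensionality; intros q; rewrite inner_eta;
        apply sumR_ext; intros; ring).
  replace (inner c n F' (G p) + inner c n (F p) G')
    with (sumR (n + 2) (fun r => eta c r * (F' r * G p r + F p r * G' r)))
    by (rewrite !inner_eta, <- sumR_plus; apply sumR_ext; intros; ring).
  apply has_pd_sumR. intros r Hr.
  exact (has_pd_scal _ _ _ _ _ (has_pd_mult _ _ _ _ _ _ (HF r Hr) (HG r Hr))).
Qed.

(** * Smooth functions and symmetry of second derivatives *)

Lemma pds_app l1 l2 f : pds (l1 ++ l2) f = pds l1 (pds l2 f).
Proof. induction l1 as [|i l1 IH]; simpl; [reflexivity|]. rewrite IH. reflexivity. Qed.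

Lemma smooth_on_pd n U i f : (i < n)%nat -> smooth_on n U f -> smooth_on n U (pd i f).
Proof.
  intros Hi H l Hl. change (pd i f) with (pds (i :: nil) f). rewrite <- pds_app.
  apply H. intros j Hj. apply List.in_app_or in Hj. destruct Hj as [Hj|[Hj|[]]].
  - apply Hl, Hj.
  - subst. assumption.
Qed.

Lemma smooth_on_has_pd n U i f p : (i < n)%nat -> U p -> smooth_on n U f ->
  has_pd i f p (pd i f p).
Proof.
  intros Hi Hp H. destruct (H nil) as [_ H']; [intros j []|].
  destruct (H' p Hp i Hi) as [l Hl]. exact (has_pd_pd i f p l Hl).
Qed.

Lemma smooth_on_continuous n U f : smooth_on n U f -> continuous_on n U f.
Proof. intros H. apply (H nil). intros j []. Qed.

Lemma openR_box n U p i j : openR n U -> U p -> (i < n)%nat -> (j < n)%nat ->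
  exists d, 0 < d /\ forall s t, Rabs s < d -> Rabs t < d -> U (shift (shift p i s) j t).
Proof.
  intros HU Hp Hi Hj. destruct (HU p Hp) as [Hpn [d [Hd H]]].
  (* Half the radius, because for [i = j] the two shifts add up. *)
  exists (d / 2). split; [lra|]. intros s t Hs Ht. apply H.
  - repeat apply shift_in_Rn; assumption.
  - intros l _.
    pose proof (shift_dist (shift p i s) j t l). pose proof (shift_dist p i s l).
    replace (_ - _) with ((shift (shift p i s) j t l - shift p i s l)
      + (shift p i s l - p l)) by ring.
    eapply Rle_lt_trans; [apply Rabs_triang|]. lra.
Qed.

Lemma continuous_on_2d n U p i j g : (i < n)%nat -> (j < n)%nat -> openR n U -> U p ->
  continuous_on n U g ->
  Continuity.continuity_2d_pt (fun s t => g (shift (shift p i s) j t)) 0 0.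
Proof.
  intros Hi Hj HU Hp Hg e. destruct (openR_box n U p i j HU Hp Hi Hj) as [d [Hd Hbox]].
  destruct (Hg p Hp e (cond_pos e)) as [d' [Hd' H]].
  assert (Hm : 0 < Rmin d (d' / 2)) by (apply Rmin_pos; lra).
  exists (mkposreal _ Hm). simpl. intros s t Hs Ht.
  rewrite Rminus_0_r in Hs, Ht. rewrite !shift_0.
  pose proof (Rmin_l d (d' / 2)). pose proof (Rmin_r d (d' / 2)).
  apply H.
  - apply Hbox; lra.
  - intros l _.
    pose proof (shift_dist (shift p i s) j t l). pose proof (shift_dist p i s l).
    replace (_ - _) with ((shift (shift p i s) j t l - shift p i s l)
      + (shift p i s l - p l)) by ring.
    eapply Rle_lt_trans; [apply Rabs_triang|]. lra.
Qed.

(** [has_pd] always differentiates at parameter 0; this moves the base point along a coordinate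
    line, as the mean value theorem and Schwarz's theorem require. *)
Lemma has_pd_line i f q (g : R -> R) u l : has_pd i f q l ->
  (forall t, f (shift q i t) = g (u + t)) -> derivable_pt_lim g u l.
Proof.
  intros H Hg e He. destruct (H e He) as [d Hd].
  exists d. intros h Hh Hhd. specialize (Hd h Hh Hhd).
  rewrite !Hg in Hd. rewrite Rplus_0_l, Rplus_0_r in Hd. exact Hd.
Qed.

Lemma Derive_eq g u l : derivable_pt_lim g u l -> Derive.Derive g u = l.
Proof. intros H. apply Derive.is_derive_unique, Derive.is_derive_Reals, H. Qed.

(** Schwarz's theorem is applied to the restriction [P] of the problem to the plane through [p]
    spanned by the two coordinate directions. *)
Lemma pd_comm n U p i j f : openR n U -> U p -> (i < n)%nat -> (j < n)%nat ->
  smooth_on n U f -> pd i (pd j f) p = pd j (pd i f) p.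
Proof.
  intros HU Hp Hi Hj Hf.
  destruct (openR_box n U p i j HU Hp Hi Hj) as [d [Hd Hbox]].
  pose (P := fun s t => shift (shift p i s) j t).
  assert (D1 : forall g, smooth_on n U g -> forall u v, Rabs u < d -> Rabs v < d ->
            derivable_pt_lim (fun z => g (P z v)) u (pd i g (P u v))).
  { intros g Hg u v Hu Hv. apply (has_pd_line i g (P u v)).
    - apply (smooth_on_has_pd n U); try assumption. apply Hbox; assumption.
    - intros t. unfold P. rewrite shift_comm, shift_shift. reflexivity. }
  assert (D2 : forall g, smooth_on n U g -> forall u v, Rabs u < d -> Rabs v < d ->
            derivable_pt_lim (fun z => g (P u z)) v (pd j g (P u v))).
  { intros g Hg u v Hu Hv. apply (has_pd_line j g (P u v)).
    - apply (smooth_on_has_pd n U); try assumption. apply Hbox; assumption.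
    - intros t. unfold P. rewrite shift_shift. reflexivity. }
  assert (nbh : forall u z, Rabs u < d -> Rabs (z - u) < d - Rabs u -> Rabs z < d).
  { intros u z Hu Hz. replace z with ((z - u) + u) by ring.
    eapply Rle_lt_trans; [apply Rabs_triang|]. lra. }
  (* Schwarz's theorem speaks of iterated [Derive]; the inner one agrees with a partial derivative
     of [f] on a whole neighbourhood, so it may be replaced before differentiating again. *)
  assert (E1 : forall u v, Rabs u < d -> Rabs v < d ->
    derivable_pt_lim (fun z => Derive.Derive (fun t => f (P z t)) v) u
      (pd i (pd j f) (P u v))).
  { intros u v Hu Hv.
    apply derivable_pt_lim_local with (fun z => pd j f (P z v)) (d - Rabs u); [lra| |].
    - intros z Hz. symmetry. apply Derive_eq, D2; try assumption. apply (nbh u); assumption.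
    - apply D1; try assumption. apply smooth_on_pd; assumption. }
  assert (E2 : forall u v, Rabs u < d -> Rabs v < d ->
    derivable_pt_lim (fun z => Derive.Derive (fun t => f (P t z)) u) v
      (pd j (pd i f) (P u v))).
  { intros u v Hu Hv.
    apply derivable_pt_lim_local with (fun z => pd i f (P u z)) (d - Rabs v); [lra| |].
    - intros z Hz. symmetry. apply Derive_eq, D1; try assumption. apply (nbh v); assumption.
    - apply D2; try assumption. apply smooth_on_pd; assumption. }
  assert (R0 : Rabs 0 < d) by (rewrite Rabs_R0; assumption).
  assert (cont : forall g (G : R -> R -> R), continuous_on n U g ->
     (forall u v, Rabs u < d -> Rabs v < d -> G u v = g (P u v)) ->
     Continuity.continuity_2d_pt G 0 0).
  { intros g G Hg HG. eapply Continuity.continuity_2d_pt_ext_loc;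
      [|apply (continuous_on_2d n U p i j g); assumption].
    exists (mkposreal d Hd). simpl. intros u v Hu Hv. rewrite Rminus_0_r in Hu, Hv.
    symmetry. apply HG; assumption. }
  pose proof (Derive_2d.Schwarz (fun u v => f (P u v)) 0 0) as Sch.
  assert (P00 : P 0 0 = p) by (unfold P; rewrite !shift_0; reflexivity).
  cbv beta in Sch.
  rewrite (Derive_eq _ _ _ (E1 0 0 R0 R0)), (Derive_eq _ _ _ (E2 0 0 R0 R0)) in Sch.
  rewrite P00 in Sch. apply Sch.
  - exists (mkposreal d Hd). simpl. intros u v Hu Hv. rewrite Rminus_0_r in Hu, Hv.
    repeat split; eexists; apply Derive.is_derive_Reals;
      [apply D1|apply D2|apply E1|apply E2]; assumption.
  - apply (cont (pd i (pd j f))).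
    + apply smooth_on_continuous. do 2 (apply smooth_on_pd; [assumption|]). assumption.
    + intros u v Hu Hv. apply Derive_eq, E1; assumption.
  - apply (cont (pd j (pd i f))).
    + apply smooth_on_continuous. do 2 (apply smooth_on_pd; [assumption|]). assumption.
    + intros u v Hu Hv. apply Derive_eq, E2; assumption.
Qed.

(** * From vanishing derivatives to constancy on a connected manifold *)

Lemma null_derivative_segment g a b : (forall x, Rmin a b <= x <= Rmax a b ->
  derivable_pt_lim g x 0) -> g a = g b.
Proof.
  intros H. destruct (Req_dec a b) as [->|ne]; [reflexivity|].
  destruct (Derive.MVT_gen g a b (fun _ => 0)) as [x [_ Hx]].
  - intros y Hy. apply Derive.is_derive_Reals, H. lra.
  - intros y Hy. apply derivable_continuous_pt. exists 0. apply H, Hy.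
  - lra.
Qed.

(* Joins [p] to a nearby point by changing one coordinate at a time. *)
Lemma locally_constant n U p h : openR n U -> U p ->
  (forall q i, U q -> (i < n)%nat -> has_pd i h q 0) ->
  exists d, 0 < d /\ forall q, in_Rn n q ->
    (forall i, (i < n)%nat -> Rabs (q i - p i) < d) -> U q /\ h q = h p.
Proof.
  intros HU Hp Hh. destruct (HU p Hp) as [Hpn [d [Hd Hbox]]].
  exists d. split; [assumption|]. intros q Hq Hqp. split; [apply Hbox; assumption|].
  (* [s m] has the first [m] coordinates of [q] and the others of [p]. *)
  pose (s := fun m i => if Nat.ltb i m then q i else p i).
  assert (Hs : forall m, (m <= n)%nat -> h (s m) = h p).
  { induction m as [|m IH]; intros Hm.
    - f_equal.
    - rewrite <- IH by lia.
      assert (sE : s (S m) = shift (s m) m (q m - p m)).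
      { apply functional_extensionality. intros i. unfold s, shift.
        destruct (Nat.eqb_spec i m) as [->|ne].
        - rewrite Nat.ltb_irrefl. destruct (Nat.ltb_spec m (S m)); [ring|lia].
        - destruct (Nat.ltb_spec i (S m)), (Nat.ltb_spec i m); try lia; reflexivity. }
      rewrite sE. symmetry. rewrite <- (shift_0 (s m) m) at 1.
      apply (null_derivative_segment (fun t => h (shift (s m) m t))).
      intros t Ht.
      apply (has_pd_line m h (shift (s m) m t)).
      + apply Hh; [|lia]. apply Hbox.
        * apply shift_in_Rn; [|lia]. intros i Hi. unfold s.
          destruct (Nat.ltb i m); [apply Hq|apply Hpn]; assumption.
        * intros i Hi. unfold shift, s. destruct (Nat.eqb_spec i m) as [->|ne].
          -- rewrite Nat.ltb_irrefl. replace (p m + t - p m) with t by ring.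
             specialize (Hqp m Hi). revert Ht Hqp. unfold Rmin, Rmax, Rabs.
             repeat destruct Rle_dec; repeat destruct Rcase_abs; lra.
          -- destruct (Nat.ltb i m); [apply Hqp, Hi|].
             replace (p i - p i) with 0 by ring. rewrite Rabs_R0. assumption.
      + intros t'. rewrite shift_shift. reflexivity. }
  rewrite <- (Hs n) by lia. f_equal. apply functional_extensionality. intros i. unfold s.
  destruct (Nat.ltb_spec i n); [reflexivity|].
  (* From index [n] on both points vanish, so [s n] and [q] agree as functions. *)
  rewrite Hq, Hpn by assumption. reflexivity.
Qed.

(** Local constancy makes every preimage under [h] open, so each level set is open with open
    complement. *)
Lemma connected_constant {M I : Type} n (U : I -> vec -> Prop) (x : I -> vec -> M) h :
  is_atlas n U x -> connected_M n U x ->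
  (forall a p i, U a p -> (i < n)%nat -> has_pd i (fun q => h (x a q)) p 0) ->
  forall m m' : M, h m = h m'.
Proof.
  intros [HU _] Hcon Hh m m'.
  assert (Hopen : forall P : R -> Prop, Mopen n U x (fun m => P (h m))).
  { intros P a p [Hp HPp].
    split; [apply (HU a), Hp|].
    destruct (locally_constant n (U a) p (fun q => h (x a q)) (HU a) Hp) as [d [Hd H]].
    - intros q i Hq Hi. apply Hh; assumption.
    - exists d. split; [assumption|]. intros q Hq Hqp.
      destruct (H q Hq Hqp) as [Hq' E]. split; [assumption|]. rewrite E. assumption. }
  destruct (Hcon (fun z => h z = h m')) as [H|H].
  - apply (Hopen (fun y => y = h m')).
  - apply (Hopen (fun y => y <> h m')).
  - apply H.
  - exfalso. apply (H m'). reflexivity.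
Qed.

(** * A hypersurface in one chart *)

(** The signs enter through $c^2=\varepsilon^2=1$, the only form in which the computations use
    them. *)
Record chart (n : nat) (c eps : R) (U : vec -> Prop) (X N : vec -> vec) : Prop := {
  chart_c : c * c = 1;
  chart_eps : eps * eps = 1;
  chart_open : openR n U;
  chart_smooth_X : forall r, (r < n + 2)%nat -> smooth_on n U (fun q => X q r);
  chart_smooth_N : forall r, (r < n + 2)%nat -> smooth_on n U (fun q => N q r);
  chart_XX : forall p, U p -> inner c n (X p) (X p) = c;
  chart_NN : forall p, U p -> inner c n (N p) (N p) = eps;
  chart_NX : forall p, U p -> inner c n (N p) (X p) = 0;
  chart_NdX : forall p i, U p -> (i < n)%nat -> inner c n (N p) (dv i X p) = 0;
  chart_det : forall p, U p -> det n (metric n c X p) <> 0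
}.

Definition trPS n c X N k p :=
  sumR n (fun i => sumR n (fun l => newtonP n c X N k p i l * shapeM n c X N p l i)).

Section Chart.
Context (n : nat) (c eps : R) (U : vec -> Prop) (X N : vec -> vec).
Context (ch : chart n c eps U X N).

Let HU := chart_open _ _ _ _ _ _ ch.

Lemma dv_has_pd F p i r : (forall r, (r < n + 2)%nat -> smooth_on n U (fun q => F q r)) ->
  U p -> (i < n)%nat -> (r < n + 2)%nat -> has_pd i (fun q => F q r) p (dv i F p r).
Proof.
  intros HF Hp Hi Hr. apply (smooth_on_has_pd n U i (fun q => F q r)); auto.
Qed.

Lemma has_pd_inner_smooth F G p i :
  (forall r, (r < n + 2)%nat -> smooth_on n U (fun q => F q r)) ->
  (forall r, (r < n + 2)%nat -> smooth_on n U (fun q => G q r)) ->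
  U p -> (i < n)%nat ->
  has_pd i (fun q => inner c n (F q) (G q)) p
    (inner c n (dv i F p) (G p) + inner c n (F p) (dv i G p)).
Proof.
  intros HF HG Hp Hi. apply has_pd_inner; intros; apply dv_has_pd; assumption.
Qed.

Lemma has_pd_inner_const b G p i :
  (forall r, (r < n + 2)%nat -> smooth_on n U (fun q => G q r)) ->
  U p -> (i < n)%nat ->
  has_pd i (fun q => inner c n b (G q)) p (inner c n b (dv i G p)).
Proof.
  intros HG Hp Hi.
  replace (inner c n b (dv i G p))
    with (inner c n (fun _ => 0) (G p) + inner c n b (dv i G p))
    by (rewrite inner_0_l by reflexivity; ring).
  apply (has_pd_inner c n i (fun _ => b)); intros.
  - apply has_pd_const.
  - apply dv_has_pd; assumption.
Qed.

Lemma inner_constant_derivative F G a p i :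
  (forall r, (r < n + 2)%nat -> smooth_on n U (fun q => F q r)) ->
  (forall r, (r < n + 2)%nat -> smooth_on n U (fun q => G q r)) ->
  (forall q, U q -> inner c n (F q) (G q) = a) -> U p -> (i < n)%nat ->
  inner c n (dv i F p) (G p) + inner c n (F p) (dv i G p) = 0.
Proof.
  intros HF HG H Hp Hi. eapply has_pd_unique.
  - apply has_pd_inner_smooth; assumption.
  - apply (has_pd_constant_on n U i _ a); assumption.
Qed.

Lemma smooth_dv F i : (i < n)%nat ->
  (forall r, (r < n + 2)%nat -> smooth_on n U (fun q => F q r)) ->
  forall r, (r < n + 2)%nat -> smooth_on n U (fun q => dv i F q r).
Proof.
  intros Hi HF r Hr. apply (smooth_on_pd n U i (fun q => F q r)); auto.
Qed.

(** * Relations obtained by differentiating constant inner products, and the Gauss formula *)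

Let SX := chart_smooth_X _ _ _ _ _ _ ch.
Let SN := chart_smooth_N _ _ _ _ _ _ ch.

Lemma dX_X p i : U p -> (i < n)%nat -> inner c n (dv i X p) (X p) = 0.
Proof.
  intros Hp Hi.
  pose proof (inner_constant_derivative X X c p i SX SX (chart_XX _ _ _ _ _ _ ch) Hp Hi) as H.
  rewrite (inner_sym c n (X p)) in H. lra.
Qed.

Lemma dX_N p i : U p -> (i < n)%nat -> inner c n (dv i X p) (N p) = 0.
Proof. intros Hp Hi. rewrite inner_sym. apply (chart_NdX _ _ _ _ _ _ ch); assumption. Qed.

Lemma dN_N p i : U p -> (i < n)%nat -> inner c n (dv i N p) (N p) = 0.
Proof.
  intros Hp Hi.
  pose proof (inner_constant_derivative N N eps p i SN SN (chart_NN _ _ _ _ _ _ ch) Hp Hi) as H.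
  rewrite (inner_sym c n (N p)) in H. lra.
Qed.

Lemma dN_X p i : U p -> (i < n)%nat -> inner c n (dv i N p) (X p) = 0.
Proof.
  intros Hp Hi.
  pose proof (inner_constant_derivative N X 0 p i SN SX (chart_NX _ _ _ _ _ _ ch) Hp Hi) as H.
  rewrite (chart_NdX _ _ _ _ _ _ ch p i Hp Hi) in H. lra.
Qed.

Lemma ddX_N p i j : U p -> (i < n)%nat -> (j < n)%nat ->
  inner c n (N p) (dv i (dv j X) p) = sff n c X N p i j.
Proof.
  intros Hp Hi Hj.
  pose proof (inner_constant_derivative N (dv j X) 0 p i SN (smooth_dv X j Hj SX)
    (fun q Hq => chart_NdX _ _ _ _ _ _ ch q j Hq Hj) Hp Hi) as H.
  unfold sff. lra.
Qed.

Lemma ddX_X p i j : U p -> (i < n)%nat -> (j < n)%nat ->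
  inner c n (X p) (dv i (dv j X) p) = - metric n c X p i j.
Proof.
  intros Hp Hi Hj.
  pose proof (inner_constant_derivative (dv j X) X 0 p i (smooth_dv X j Hj SX) SX
    (fun q Hq => dX_X q j Hq Hj) Hp Hi) as H.
  unfold metric. rewrite (inner_sym c n (X p)), (inner_sym c n (dv i X p)). lra.
Qed.

Lemma ddX_sym p i j r : U p -> (i < n)%nat -> (j < n)%nat -> (r < n + 2)%nat ->
  dv i (dv j X) p r = dv j (dv i X) p r.
Proof.
  intros Hp Hi Hj Hr. apply (pd_comm n U p i j (fun q => X q r)); auto.
Qed.

Lemma metric_sym p i j : metric n c X p i j = metric n c X p j i.
Proof. apply inner_sym. Qed.

Lemma pd_metric p i j l : U p -> (i < n)%nat -> (j < n)%nat -> (l < n)%nat ->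
  pd i (fun q => metric n c X q j l) p
  = inner c n (dv i (dv j X) p) (dv l X p) + inner c n (dv i (dv l X) p) (dv j X p).
Proof.
  intros Hp Hi Hj Hl. apply pd_eq. rewrite (inner_sym c n (dv i (dv l X) p)).
  apply (has_pd_inner_smooth (dv j X) (dv l X)); try assumption;
    apply smooth_dv; assumption.
Qed.

(** The three derivatives of the metric expand into six products; by symmetry of second derivatives
    four cancel and the other two coincide, which absorbs the factor 1/2. *)
Lemma christoffel_lowered p i j l : U p -> (i < n)%nat -> (j < n)%nat -> (l < n)%nat ->
  sumR n (fun m => christ n c X p m i j * metric n c X p m l)
  = inner c n (dv i (dv j X) p) (dv l X p).
Proof.
  intros Hp Hi Hj Hl.
  pose (K := fun l => inner c n (dv i (dv j X) p) (dv l X p)).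
  assert (HK : forall m, christ n c X p m i j = sumR n (fun l => ginv n c X p m l * K l)).
  { intros m. unfold christ. rewrite <- sumR_scal. apply sumR_ext. intros s Hs.
    rewrite !pd_metric by assumption. unfold K.
    rewrite (inner_ext c n (dv j (dv i X) p) (dv i (dv j X) p) (dv s X p) (dv s X p))
      by (intros; try reflexivity; apply ddX_sym; assumption).
    rewrite (inner_ext c n (dv s (dv i X) p) (dv i (dv s X) p) (dv j X p) (dv j X p))
      by (intros; try reflexivity; apply ddX_sym; assumption).
    rewrite (inner_ext c n (dv s (dv j X) p) (dv j (dv s X) p) (dv i X p) (dv i X p))
      by (intros; try reflexivity; apply ddX_sym; assumption).
    field. }
  rewrite (sumR_ext n _ (fun m => sumR n (fun s =>
    K s * (metric n c X p l m * ginv n c X p m s)))).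
  - rewrite sumR_swap.
    rewrite (sumR_ext n _ (fun s => K s * idm s l)); [apply sumR_idm; assumption|].
    intros s Hs. rewrite sumR_scal. f_equal. unfold ginv.
    rewrite mul_inv_r by (try apply (chart_det _ _ _ _ _ _ ch); assumption).
    unfold idm. rewrite Nat.eqb_sym. reflexivity.
  - intros m Hm. rewrite HK, Rmult_comm, <- sumR_scal. apply sumR_ext. intros s _.
    rewrite (metric_sym p m l). ring.
Qed.

Lemma frame_zero p w : U p ->
  (forall i, (i < n)%nat -> inner c n (dv i X p) w = 0) ->
  inner c n (N p) w = 0 -> inner c n (X p) w = 0 ->
  forall r, (r < n + 2)%nat -> w r = 0.
Proof.
  intros Hp H1 H2 H3.
  pose proof (chart_c _ _ _ _ _ _ ch). pose proof (chart_eps _ _ _ _ _ _ ch).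
  apply (frame_complete n c eps (fun i => dv i X p) (N p) (X p) w); try assumption.
  - intros ->. lra.
  - intros ->. lra.
  - apply (chart_det _ _ _ _ _ _ ch p Hp).
  - intros; apply dX_N; assumption.
  - intros; apply dX_X; assumption.
  - apply (chart_NX _ _ _ _ _ _ ch p Hp).
  - apply (chart_NN _ _ _ _ _ _ ch p Hp).
  - apply (chart_XX _ _ _ _ _ _ ch p Hp).
Qed.

(** The difference [w] of the two sides is orthogonal to the whole frame. The factors [eps] and [c]
    are the inverses of $\langle N,N\rangle$ and $\langle\psi,\psi\rangle$. *)
Lemma gauss_formula p i j r : U p -> (i < n)%nat -> (j < n)%nat -> (r < n + 2)%nat ->
  dv i (dv j X) p r = sumR n (fun m => christ n c X p m i j * dv m X p r)
    + eps * sff n c X N p i j * N p r - c * metric n c X p i j * X p r.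
Proof.
  intros Hp Hi Hj Hr.
  pose proof (chart_c _ _ _ _ _ _ ch) as Hc. pose proof (chart_eps _ _ _ _ _ _ ch) as He.
  pose (T := fun r => sumR n (fun m => christ n c X p m i j * dv m X p r)).
  pose (a := - (eps * sff n c X N p i j)). pose (b := c * metric n c X p i j).
  pose (w := fun r => (1 * dv i (dv j X) p r + (-1) * T r + a * N p r) + b * X p r).
  enough (H : w r = 0) by (unfold w, T, a, b in H; lra).
  assert (Hw : forall v, inner c n v w = inner c n (dv i (dv j X) p) v
    - sumR n (fun m => christ n c X p m i j * inner c n (dv m X p) v)
    + a * inner c n (N p) v + b * inner c n (X p) v).
  { intros v. unfold w.
    rewrite inner_sym, inner_plus_l, inner_comb3, inner_scal_l. unfold T.
    rewrite (inner_lincomb_l c n n _ (fun m => dv m X p)). ring. }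
  apply (frame_zero p w); try assumption.
  - intros l Hl. rewrite Hw, (chart_NdX _ _ _ _ _ _ ch) by assumption.
    rewrite (inner_sym c n (X p)), dX_X by assumption.
    rewrite <- (christoffel_lowered p i j l) by assumption. unfold metric. ring.
  - rewrite Hw, sumR_0 by (intros; rewrite dX_N by assumption; ring).
    rewrite (chart_NN _ _ _ _ _ _ ch p Hp), (inner_sym c n (X p)),
      (chart_NX _ _ _ _ _ _ ch p Hp), inner_sym, ddX_N by assumption.
    unfold a. transitivity (sff n c X N p i j * (1 - eps * eps)); [ring|].
    rewrite He. ring.
  - rewrite Hw, sumR_0 by (intros; rewrite dX_X by assumption; ring).
    rewrite (chart_NX _ _ _ _ _ _ ch p Hp), (chart_XX _ _ _ _ _ _ ch p Hp),
      inner_sym, ddX_X by assumption.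
    unfold b. transitivity (metric n c X p i j * (c * c - 1)); [ring|].
    rewrite Hc. ring.
Qed.

(** The Christoffel term subtracted in the Hessian is exactly the tangential part of the Gauss
    formula, so only the two normal directions remain. *)
Lemma hessE_coordinate p l i r : U p -> (l < n)%nat -> (i < n)%nat -> (r < n + 2)%nat ->
  hessE n c X (fun q => X q r) p l i
  = eps * shapeM n c X N p l i * N p r - c * idm l i * X p r.
Proof.
  intros Hp Hl Hi Hr. unfold hessE, shapeM.
  rewrite (sumR_ext n _ (fun j => (eps * N p r) * (ginv n c X p l j * sff n c X N p i j)
    + (- (c * X p r)) * (ginv n c X p l j * metric n c X p j i))).
  - rewrite sumR_plus, !sumR_scal. unfold ginv at 2.
    rewrite mul_inv_l by (try apply (chart_det _ _ _ _ _ _ ch); assumption). ring.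
  - intros j Hj. change (pd i (pd j (fun q => X q r)) p) with (dv i (dv j X) p r).
    rewrite gauss_formula by assumption. unfold dv at 1. rewrite (metric_sym p j i). ring.
Qed.

Lemma Lk_coordinate k p r : (k < n)%nat -> U p -> (r < n + 2)%nat ->
  Lk n c X N k (fun q => X q r) p
  = eps * trPS n c X N k p * N p r - c * (INR (n - k) * acoef n c X N p k) * X p r.
Proof.
  intros Hk Hp Hr. unfold Lk, acoef.
  rewrite <- trace_newton_transform by assumption.
  transitivity ((eps * N p r) * trPS n c X N k p + (- (c * X p r)) *
    sumR n (fun i => newtonP n c X N k p i i)); [|unfold newtonP, acoef; ring].
  unfold trPS. rewrite <- !sumR_scal, <- sumR_plus. apply sumR_ext. intros i Hi.
  (* The diagonal entry becomes a sum against [idm], to be compared with the double sum in [Lk] term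
     by term. *)
  rewrite <- (sumR_idm n (newtonP n c X N k p i) i Hi).
  rewrite <- !sumR_scal, <- sumR_plus. apply sumR_ext. intros l Hl.
  rewrite hessE_coordinate by assumption. ring.
Qed.

Lemma metric_nonzero p : (0 < n)%nat -> U p ->
  ~ (forall i j, (i < n)%nat -> (j < n)%nat -> metric n c X p i j = 0).
Proof.
  intros Hn Hp H.
  pose proof (mul_inv_r n _ 0 0 (chart_det _ _ _ _ _ _ ch p Hp) Hn Hn) as E.
  rewrite idm_same, sumR_0 in E; [lra|].
  intros i Hi. rewrite H by assumption. ring.
Qed.

(** * Hypersurfaces contained in a section $\langle a,x\rangle=\tau$ *)

(** Differentiating $\langle a,\psi\rangle=\tau$ shows that [a] has no tangential component; the
    rest is its expansion in $N$ and $\psi$. *)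
Lemma umbilic_expansion a tau p : (forall q, U q -> inner c n a (X q) = tau) -> U p ->
  forall r, (r < n + 2)%nat -> a r = eps * inner c n a (N p) * N p r + c * tau * X p r.
Proof.
  intros Ha Hp r Hr.
  pose proof (chart_c _ _ _ _ _ _ ch) as Hc. pose proof (chart_eps _ _ _ _ _ _ ch) as He.
  pose (w := fun r => 1 * a r + (- (eps * inner c n a (N p))) * N p r + (- (c * tau)) * X p r).
  enough (H : w r = 0) by (unfold w in H; lra).
  assert (Hw : forall v, inner c n v w = inner c n a v
     - eps * inner c n a (N p) * inner c n (N p) v - c * tau * inner c n (X p) v).
  { intros v. unfold w. rewrite inner_sym, inner_comb3. ring. }
  apply (frame_zero p w); try assumption.
  - intros i Hi. rewrite Hw, (chart_NdX _ _ _ _ _ _ ch) by assumption.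
    rewrite (inner_sym c n (X p)), dX_X by assumption.
    rewrite (has_pd_unique i (fun q => inner c n a (X q)) p (inner c n a (dv i X p)) 0);
      [ring|apply has_pd_inner_const; assumption|].
    apply (has_pd_constant_on n U i _ tau); assumption.
  - rewrite Hw, (chart_NN _ _ _ _ _ _ ch p Hp), (inner_sym c n (X p)),
      (chart_NX _ _ _ _ _ _ ch p Hp).
    transitivity (inner c n a (N p) * (1 - eps * eps)); [ring|]. rewrite He. ring.
  - rewrite Hw, (chart_NX _ _ _ _ _ _ ch p Hp), (chart_XX _ _ _ _ _ _ ch p Hp), Ha by assumption.
    transitivity (tau * (1 - c * c)); [ring|]. rewrite Hc. ring.
Qed.

(** Pairing the expansion of [a] with [a]. With $\nu=\langle a,N\rangle$ it gives $\langle
    a,a\rangle-c\tau^2=\varepsilon\nu^2$: being non-totally-geodesic means $\nu\ne0$. *)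
Lemma umbilic_norm a tau p : (forall q, U q -> inner c n a (X q) = tau) -> U p ->
  inner c n a a = eps * (inner c n a (N p) * inner c n a (N p)) + c * tau ^ 2.
Proof.
  intros Ha Hp.
  rewrite (inner_ext c n a (fun r => eps * inner c n a (N p) * N p r + c * tau * X p r) a a)
    by (intros; try reflexivity; apply umbilic_expansion; assumption).
  rewrite inner_plus_l, !inner_scal_l, !(inner_sym c n _ a), (Ha p Hp). ring.
Qed.

Lemma umbilic_normal_constant a tau p i : (forall q, U q -> inner c n a (X q) = tau) ->
  U p -> (i < n)%nat -> has_pd i (fun q => inner c n a (N q)) p 0.
Proof.
  intros Ha Hp Hi.
  enough (H : inner c n a (dv i N p) = 0)
    by (rewrite <- H; apply has_pd_inner_const; assumption).
  rewrite (inner_ext c n a (fun r => eps * inner c n a (N p) * N p r + c * tau * X p r)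
    (dv i N p) (dv i N p)) by (intros; try reflexivity; apply umbilic_expansion; assumption).
  rewrite inner_plus_l, !inner_scal_l, !(inner_sym c n _ (dv i N p)), dN_N, dN_X by assumption.
  ring.
Qed.

(** Differentiates the expansion of the constant vector [a], whose coefficients are constant too.
    For $\nu\ne0$ it says that $S$ is the scalar $\varepsilon c\tau/\nu$. *)
Lemma umbilic_dN a tau p i r : (forall q, U q -> inner c n a (X q) = tau) ->
  U p -> (i < n)%nat -> (r < n + 2)%nat ->
  eps * inner c n a (N p) * dv i N p r + c * tau * dv i X p r = 0.
Proof.
  intros Ha Hp Hi Hr.
  apply (has_pd_unique i (fun q => eps * inner c n a (N q) * N q r + c * tau * X q r) p).
  - replace (eps * inner c n a (N p) * dv i N p r)
      with (eps * 0 * N p r + eps * inner c n a (N p) * dv i N p r) by ring.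
    apply has_pd_plus.
    + apply (has_pd_mult i (fun q => eps * inner c n a (N q)) (fun q => N q r)).
      * apply has_pd_scal. apply (umbilic_normal_constant a tau); assumption.
      * apply dv_has_pd; assumption.
    + apply has_pd_scal, dv_has_pd; assumption.
  - apply (has_pd_constant_on n U i _ (a r)); try assumption.
    intros q Hq. symmetry. apply umbilic_expansion; assumption.
Qed.

End Chart.

Lemma shapeM_scalar n c eps U X N p lam :
  chart n c eps U X N -> U p ->
  (forall i r, (i < n)%nat -> (r < n + 2)%nat -> dv i N p r = - lam * dv i X p r) ->
  forall l i, (l < n)%nat -> (i < n)%nat -> shapeM n c X N p l i = lam * idm l i.
Proof.
  intros ch Hp HN l i Hl Hi. unfold shapeM.
  rewrite <- (mul_inv_l n _ l i (chart_det _ _ _ _ _ _ ch p Hp) Hl Hi), <- sumR_scal.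
  apply sumR_ext. intros j Hj. unfold sff, ginv.
  rewrite (inner_ext c n (dv i N p) (fun r => - lam * dv i X p r) (dv j X p) (dv j X p))
    by (intros; try reflexivity; apply HN; assumption).
  rewrite inner_scal_l, (metric_sym n c X p j i). unfold metric. ring.
Qed.

Lemma trPS_scalar n c X N k p lam : (k < n)%nat ->
  (forall l i, (l < n)%nat -> (i < n)%nat -> shapeM n c X N p l i = lam * idm l i) ->
  trPS n c X N k p = lam * (INR (n - k) * acoef n c X N p k).
Proof.
  intros Hk HS. unfold acoef. rewrite <- trace_newton_transform by assumption.
  unfold trPS. rewrite <- sumR_scal. apply sumR_ext. intros i Hi.
  rewrite (sumR_ext n _ (fun l => (lam * newtonP n c X N k p i l) * idm l i)).
  - rewrite (sumR_idm n (fun l => lam * newtonP n c X N k p i l)) by assumption.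
    reflexivity.
  - intros l Hl. rewrite HS by assumption. ring.
Qed.

(** * From the affine equation to a section that is not totally geodesic *)

Definition mvec n (A : nat -> nat -> R) (u : vec) : vec :=
  fun r => sumR (n + 2) (fun s => A r s * u s).

(** The field $F=A\psi+b$ is normal to $M$ and $\langle F,\psi\rangle=\beta c$. Differentiating,
    $0=\langle A\partial_i\psi,\psi\rangle+\langle
    F,\partial_i\psi\rangle=\langle\partial_i\psi,A\psi\rangle$ by self-adjointness; subtracting
    this from $\langle F,\partial_i\psi\rangle=0$ leaves $\langle b,\partial_i\psi\rangle=0$. The
    function [alpha] is arbitrary. *)
Lemma affine_orthogonal n c eps U X N A b alpha beta :
  chart n c eps U X N -> self_adjoint n c A ->
  (forall p r, U p -> (r < n + 2)%nat ->
     alpha p * N p r + beta * X p r = mvec n A (X p) r + b r) ->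
  forall p i, U p -> (i < n)%nat -> inner c n b (dv i X p) = 0.
Proof.
  intros ch HA HL p i Hp Hi.
  pose (F := fun q r => mvec n A (X q) r + b r).
  assert (FE : forall q v, U q -> inner c n (F q) v
             = alpha q * inner c n (N q) v + beta * inner c n (X q) v).
  { intros q v Hq. rewrite <- !inner_scal_l, <- inner_plus_l.
    apply inner_ext; [|reflexivity]. intros r Hr. symmetry. apply HL; assumption. }
  assert (FX : has_pd i (fun q => inner c n (F q) (X q)) p 0).
  { apply (has_pd_constant_on n U i _ (beta * c) p (chart_open _ _ _ _ _ _ ch) Hp Hi).
    intros q Hq. rewrite FE, (chart_NX _ _ _ _ _ _ ch), (chart_XX _ _ _ _ _ _ ch)
      by assumption. ring. }
  assert (dFX : has_pd i (fun q => inner c n (F q) (X q)) p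
    (inner c n (mvec n A (dv i X p)) (X p) + inner c n (F p) (dv i X p))).
  { apply has_pd_inner; intros r Hr.
    - replace (mvec n A (dv i X p) r) with (mvec n A (dv i X p) r + 0) by ring.
      apply has_pd_plus; [|apply has_pd_const].
      apply has_pd_sumR. intros s Hs. apply has_pd_scal.
      apply (dv_has_pd n U); try assumption. apply (chart_smooth_X _ _ _ _ _ _ ch).
    - apply (dv_has_pd n U); try assumption. apply (chart_smooth_X _ _ _ _ _ _ ch). }
  pose proof (has_pd_unique _ _ _ _ _ FX dFX) as E.
  rewrite FE, (chart_NdX _ _ _ _ _ _ ch), (inner_sym c n (X p) (dv i X p)),
    (dX_X n c eps U X N ch) in E by assumption.
  unfold mvec in E at 1. rewrite HA in E.
  fold (mvec n A (X p)) in E.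
  assert (E' : inner c n (F p) (dv i X p) = 0).
  { rewrite FE, (chart_NdX _ _ _ _ _ _ ch), (inner_sym c n (X p)),
      (dX_X n c eps U X N ch) by assumption. ring. }
  unfold F in E'. rewrite inner_plus_l, (inner_sym c n (mvec n A (X p))) in E'. lra.
Qed.

(* A totally geodesic [M] satisfies [A psi + b = beta psi], so [<psi, A b> = - <b, b>] is
   constant; differentiating twice, the Gauss formula makes the metric vanish. *)
Lemma affine_not_geodesic n c eps k U X N A b beta p :
  (k < n)%nat -> chart n c eps U X N -> self_adjoint n c A -> nonzero_vec n b ->
  (forall p r, U p -> (r < n + 2)%nat ->
     eps * trPS n c X N k p * N p r + beta * X p r = mvec n A (X p) r + b r) ->
  (forall q, U q -> inner c n b (X q) = 0) -> U p -> False.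
Proof.
  intros Hk ch HA [r0 [Hr0 Hb]] HL Hperp Hp.
  pose proof (chart_c _ _ _ _ _ _ ch) as Hc. pose proof (chart_eps _ _ _ _ _ _ ch) as He.
  (* For $\tau=0$ the expansion reads $b=\varepsilon\nu N$, so $\nu=0$ would force $b=0$. *)
  assert (Hnu : forall q, U q -> eps * inner c n b (N q) <> 0).
  { intros q Hq E. apply Hb.
    rewrite (umbilic_expansion n c eps U X N ch b 0 q Hperp Hq r0 Hr0), E. ring. }
  assert (dN0 : forall q i r, U q -> (i < n)%nat -> (r < n + 2)%nat -> dv i N q r = 0).
  { intros q i r Hq Hi Hr.
    pose proof (umbilic_dN n c eps U X N ch b 0 q i r Hperp Hq Hi Hr) as E.
    apply (Rmult_eq_reg_l (eps * inner c n b (N q))); [lra|apply Hnu, Hq]. }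
  assert (S0 : forall q l i, U q -> (l < n)%nat -> (i < n)%nat ->
             shapeM n c X N q l i = 0 * idm l i).
  { intros q l i Hq Hl Hi. apply (shapeM_scalar n c eps U); try assumption.
    intros j r Hj Hr. rewrite dN0 by assumption. ring. }
  assert (AX : forall q, U q -> inner c n (X q) (mvec n A b) = - inner c n b b).
  { intros q Hq. unfold mvec. rewrite <- HA. fold (mvec n A (X q)).
    assert (E : inner c n (fun r => mvec n A (X q) r + b r) b = 0).
    { rewrite (inner_ext c n _ (fun r => beta * X q r) b b); [|intros r Hr|reflexivity].
      - rewrite inner_scal_l, inner_sym, Hperp by assumption. ring.
      (* Here $S=0$, so the normal term of the equation vanishes. *)
      - rewrite <- HL, (trPS_scalar n c X N k q 0 Hk) by auto. ring. }
    rewrite inner_plus_l in E. lra. }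
  pose proof (chart_smooth_X _ _ _ _ _ _ ch) as SX.
  assert (dAX : forall q i, U q -> (i < n)%nat -> inner c n (mvec n A b) (dv i X q) = 0).
  { intros q i Hq Hi.
    apply (has_pd_unique i (fun q => inner c n (mvec n A b) (X q)) q).
    - apply (has_pd_inner_const n c U); assumption.
    - apply (has_pd_constant_on n U i _ (- inner c n b b) q (chart_open _ _ _ _ _ _ ch) Hq Hi).
      intros q' Hq'. rewrite inner_sym. apply AX, Hq'. }
  assert (ddAX : forall i j, (i < n)%nat -> (j < n)%nat ->
            inner c n (mvec n A b) (dv i (dv j X) p) = 0).
  { intros i j Hi Hj.
    apply (has_pd_unique i (fun q => inner c n (mvec n A b) (dv j X q)) p).
    - apply (has_pd_inner_const n c U); try assumption. apply smooth_dv; assumption.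
    - apply (has_pd_constant_on n U i _ 0 p (chart_open _ _ _ _ _ _ ch) Hp Hi).
      intros q Hq. apply dAX; assumption. }
  apply (metric_nonzero n c eps U X N ch p); [lia|assumption|].
  intros i j Hi Hj.
  assert (Hbb : c * inner c n b b <> 0).
  { rewrite (umbilic_norm n c eps U X N ch b 0 p Hperp Hp). intros E.
    apply (Rmult_integral_contrapositive_currified _ _ (Hnu p Hp) (Hnu p Hp)).
    transitivity (eps * c * (c * (eps * (inner c n b (N p) * inner c n b (N p)) + c * 0 ^ 2)));
      [|rewrite E; ring].
    transitivity ((c * c) * (eps * inner c n b (N p) * (eps * inner c n b (N p))));
      [rewrite Hc|]; ring. }
  (* Pairing the Gauss formula with $Ab$ leaves $-cg_{ij}\langle\psi,Ab\rangle=cg_{ij}\langle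
     b,b\rangle$, and [ddAX] says that this is zero. *)
  apply (Rmult_eq_reg_l (c * inner c n b b)); [|assumption].
  rewrite Rmult_0_r, <- (ddAX i j Hi Hj), (inner_sym c n (mvec n A b)).
  rewrite (inner_ext c n _ (fun r => sumR n (fun m => christ n c X p m i j * dv m X p r)
    + (- (c * metric n c X p i j)) * X p r) (mvec n A b) (mvec n A b));
    [|intros r Hr|reflexivity].
  - rewrite inner_plus_l, inner_scal_l,
      (inner_lincomb_l c n n _ (fun m => dv m X p)), AX by assumption.
    rewrite sumR_0 by (intros m Hm; rewrite inner_sym, dAX by assumption; ring). ring.
  - rewrite (gauss_formula n c eps U X N ch) by assumption.
    replace (sff n c X N p i j) with 0; [ring|].
    unfold sff. rewrite inner_0_l by (intros; apply dN0; assumption). ring.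
Qed.

(** Equality forces $\nu=0$, hence $b=c\tau\psi$; as $\tau\ne0$, the derivatives of $\psi$ would
    vanish and with them the metric. *)
Lemma umbilic_not_totally_geodesic n c eps U X N b tau p :
  (0 < n)%nat -> chart n c eps U X N -> nonzero_vec n b ->
  (forall q, U q -> inner c n b (X q) = tau) -> U p -> tau <> 0 ->
  inner c n b b - c * tau ^ 2 <> 0.
Proof.
  intros Hn ch Hb Htau Hp Ht E.
  pose proof (chart_c _ _ _ _ _ _ ch) as Hc. pose proof (chart_eps _ _ _ _ _ _ ch) as He.
  rewrite (umbilic_norm n c eps U X N ch b tau p Htau Hp) in E.
  assert (Hnu : inner c n b (N p) = 0).
  { apply Rsqr_0_uniq. unfold Rsqr.
    apply (Rmult_eq_reg_l eps); [lra|]. intros ->. lra. }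
  assert (dX0 : forall i r, (i < n)%nat -> (r < n + 2)%nat -> dv i X p r = 0).
  { intros i r Hi Hr.
    pose proof (umbilic_dN n c eps U X N ch b tau p i r Htau Hp Hi Hr) as E'.
    rewrite Hnu in E'. apply (Rmult_eq_reg_l (c * tau)); [lra|].
    apply Rmult_integral_contrapositive_currified; [intros ->; lra|assumption]. }
  apply (metric_nonzero n c eps U X N ch p Hn Hp). intros i j Hi Hj.
  apply inner_0_l. intros r Hr. apply dX0; assumption.
Qed.

(** Substitutes $\varepsilon N=(a-c\tau\psi)/\nu$ and $S=\lambda I$ into the formula for $L_k\psi$.
    If $\tau\ne0$ then $\lambda\ne0$, so $T=(n-k)a_k$ is nonzero. *)
Lemma umbilic_Lk n c eps k U X N a tau p r :
  (k < n)%nat -> chart n c eps U X N -> (forall q, U q -> inner c n a (X q) = tau) ->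
  U p -> inner c n a (N p) <> 0 -> (r < n + 2)%nat ->
  let nu := inner c n a (N p) in
  let lam := c * tau * eps / nu in
  let T := INR (n - k) * acoef n c X N p k in
  Lk n c X N k (fun q => X q r) p
  = T * lam / nu * a r + (- (T * lam * c * tau / nu) - c * T) * X p r
  /\ (tau <> 0 -> T <> 0).
Proof.
  intros Hk ch Ha Hp Hnu Hr nu lam T.
  pose proof (chart_c _ _ _ _ _ _ ch) as Hc. pose proof (chart_eps _ _ _ _ _ _ ch) as He.
  assert (He0 : eps <> 0) by (intros ->; lra).
  assert (HS : forall l i, (l < n)%nat -> (i < n)%nat ->
             shapeM n c X N p l i = lam * idm l i).
  { apply (shapeM_scalar n c eps U); try assumption. intros i s Hi Hs.
    pose proof (umbilic_dN n c eps U X N ch a tau p i s Ha Hp Hi Hs) as E.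
    apply (Rmult_eq_reg_l (eps * nu));
      [|apply Rmult_integral_contrapositive_currified; assumption].
    fold nu in E. transitivity (- (eps * eps) * (c * tau * dv i X p s)).
    - rewrite He. lra.
    - unfold lam. field. exact Hnu. }
  split.
  - rewrite (Lk_coordinate n c eps U X N ch) by assumption.
    rewrite (trPS_scalar n c X N k p lam Hk HS). fold T.
    rewrite (umbilic_expansion n c eps U X N ch a tau p Ha Hp r Hr). fold nu.
    field. exact Hnu.
  - intros Ht. unfold T. apply Rmult_integral_contrapositive_currified.
    + apply not_0_INR. lia.
    + apply (charcoef_scalar_neq0 n _ lam k); [lia| |exact HS].
      unfold lam. apply Rmult_integral_contrapositive_currified;
        [|apply Rinv_neq_0_compat, Hnu].
      repeat apply Rmult_integral_contrapositive_currified; try assumption.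
      intros ->. lra.
Qed.

(** * Intrinsic types of the sections *)

Lemma square_root_exists y : 0 < y ->
  exists r, 0 < r /\ r ^ 2 = y /\ (1 < y -> 1 < r) /\ (y < 1 -> r < 1).
Proof.
  intros Hy. exists (sqrt y).
  assert (E : sqrt y ^ 2 = y) by (apply pow2_sqrt; lra).
  pose proof (sqrt_lt_R0 y Hy). repeat split; try assumption; intros; nra.
Qed.

(** With $z=\tau^2/\langle a,a\rangle$ the squared radius is $|1-z|$. The sign of $\langle
    a,a\rangle$ is that of $z$, and $z=1$ is the excluded degenerate section. *)
Lemma in_umbilic_case_i n {M : Type} (psi : M -> vec) a tau :
  in_umbilic n 1 psi a tau -> case_i n psi.
Proof.
  intros H. exists a, tau. split; [assumption|]. cbv zeta.
  destruct H as [_ [Ht [Hne _]]]. set (aa := inner 1 n a a) in *.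
  assert (Ht2 : 0 < tau ^ 2) by nra.
  destruct (Rtotal_order aa 0) as [Haa|[Haa|Haa]]; [|right; right; right; assumption|];
    assert (Hz : tau ^ 2 / aa * aa = tau ^ 2) by (field; lra);
    set (z := tau ^ 2 / aa) in *.
  - left. destruct (square_root_exists (1 - z)) as [r [Hr [E [H1 _]]]]; [nra|].
    exists r. repeat split; try assumption. apply H1. nra.
  - right. destruct (Rtotal_order z 1) as [H|[H|H]].
    + right. left. destruct (square_root_exists (1 - z)) as [r [Hr [E [_ H1]]]]; [lra|].
      exists r. repeat split; try assumption. apply H1. nra.
    + exfalso. apply Hne. rewrite H in Hz. lra.
    + left. destruct (square_root_exists (z - 1)) as [r [Hr [E _]]]; [lra|].
      exists r. repeat split; try assumption. lra.
Qed.

(** Here the squared radius is $|1+z|$, and the degenerate value is $z=-1$. *)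
Lemma in_umbilic_case_ii n {M : Type} (psi : M -> vec) a tau :
  in_umbilic n (-1) psi a tau -> case_ii n psi.
Proof.
  intros H. exists a, tau. split; [assumption|]. cbv zeta.
  destruct H as [_ [Ht [Hne _]]]. set (aa := inner (-1) n a a) in *.
  assert (Ht2 : 0 < tau ^ 2) by nra.
  destruct (Rtotal_order aa 0) as [Haa|[Haa|Haa]]; [|right; right; right; assumption|];
    assert (Hz : tau ^ 2 / aa * aa = tau ^ 2) by (field; lra);
    set (z := tau ^ 2 / aa) in *.
  - right. destruct (Rtotal_order z (-1)) as [H|[H|H]].
    + right. left. destruct (square_root_exists (-1 - z)) as [r [Hr [E _]]]; [lra|].
      exists r. repeat split; assumption.
    + exfalso. apply Hne. rewrite H in Hz. lra.
    + left. destruct (square_root_exists (1 + z)) as [r [Hr [E [_ H1]]]]; [lra|].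
      exists r. repeat split; try assumption; [apply H1; nra|lra].
  - left. destruct (square_root_exists (1 + z)) as [r [Hr [E [H1 _]]]]; [nra|].
    exists r. repeat split; try assumption; [apply H1; nra|lra].
Qed.

(** The listed types are exhaustive, so the theorem reduces to the existence of a section containing
    $M$. *)
Lemma in_umbilic_cases n c {M : Type} (psi : M -> vec) : (c = 1 \/ c = -1) ->
  (exists a tau, in_umbilic n c psi a tau) <->
  ((c = 1 /\ case_i n psi) \/ (c = -1 /\ case_ii n psi)).
Proof.
  intros Hc. split.
  - intros [a [tau H]]. destruct Hc as [-> | ->].
    + left. split; [reflexivity|]. exact (in_umbilic_case_i n psi a tau H).
    + right. split; [reflexivity|]. exact (in_umbilic_case_ii n psi a tau H).
  - intros [[-> [a [tau [H _]]]]|[-> [a [tau [H _]]]]]; exists a, tau; exact H.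
Qed.

(** * From charts to the whole manifold *)

Lemma hypersurface_chart n c eps (M I : Type) (U : I -> vec -> Prop) (x : I -> vec -> M)
  (psi N : M -> vec) a : (c = 1 \/ c = -1) -> (eps = 1 \/ eps = -1) ->
  hypersurface n c eps U x psi N ->
  chart n c eps (U a) (fun q => psi (x a q)) (fun q => N (x a q)).
Proof.
  intros Hc He ([HU _] & _ & _ & HXX & HNN & HNX & Hs & HNd & Hdet). constructor.
  - destruct Hc as [-> | ->]; ring.
  - destruct He as [-> | ->]; ring.
  - apply HU.
  - intros r Hr. apply Hs, Hr.
  - intros r Hr. apply Hs, Hr.
  - intros; apply HXX.
  - intros; apply HNN.
  - intros; apply HNX.
  - intros p i Hp Hi. apply HNd; assumption.
  - intros p Hp. apply Hdet, Hp.
Qed.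

Lemma Hk_constant_acoef n c eps k (M I : Type) (U : I -> vec -> Prop) (x : I -> vec -> M)
  (psi N : M -> vec) : (eps = 1 \/ eps = -1) -> Hk_constant n c eps k U x psi N ->
  exists ak, forall a p, U a p ->
    acoef n c (fun q => psi (x a q)) (fun q => N (x a q)) p k = ak.
Proof.
  intros He [H HH]. exists (C n k * H / (- eps) ^ k). intros a p Hp.
  rewrite (HH a p Hp). field. apply pow_nonzero. lra.
Qed.

(* Takes [tau = 1] and a null [a]; nothing in [hypersurface] prevents [M] from being empty. *)
Lemma empty_in_umbilic n c {M : Type} (psi : M -> vec) : (0 < n)%nat -> (c = 1 \/ c = -1) ->
  (M -> False) -> exists a tau, in_umbilic n c psi a tau.
Proof.
  intros Hn Hc HM.
  (* A null vector needs a spacelike direction beside coordinate 0: coordinate 1 if $c=1$, otherwise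
     coordinate 2, present because $n>0$. *)
  pose (j := if Rle_dec 0 c then 1%nat else 2%nat).
  exists (fun r => idm r 0 + idm r j), 1.
  assert (Hj : (0 < j < n + 2)%nat) by (unfold j; destruct Rle_dec; lia).
  assert (E : inner c n (fun r => idm r 0 + idm r j) (fun r => idm r 0 + idm r j) = 0).
  { rewrite inner_eta.
    rewrite (sumR_ext _ _ (fun r => (eta c r * (idm r 0 + idm r j)) * idm r 0
       + (eta c r * (idm r 0 + idm r j)) * idm r j)) by (intros; ring).
    rewrite sumR_plus, !(sumR_idm (n + 2) (fun r => eta c r * (idm r 0 + idm r j))) by lia.
    rewrite !idm_same, (idm_diff 0 j), (idm_diff j 0) by lia.
    unfold j. destruct Rle_dec; simpl; lra. }
  repeat split.
  - exists 0%nat. split; [lia|]. rewrite idm_same, idm_diff by lia. lra.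
  - lra.
  - rewrite E. lra.
  - intros m. destruct (HM m).
Qed.

Theorem theorem2 (n : nat) (c eps : R) (k : nat) (M I : Type)
  (U : I -> vec -> Prop) (x : I -> vec -> M) (psi N : M -> vec) :
  (c = 1 \/ c = -1) -> (eps = 1 \/ eps = -1) -> (k < n)%nat ->
  hypersurface n c eps U x psi N ->
  Hk_constant n c eps k U x psi N ->
  ((exists (A : nat -> nat -> R) (b : vec),
       self_adjoint n c A /\ nonzero_vec n b /\ Lk_affine n c k U x psi N A b)
   <->
   ((c = 1 /\ case_i n psi) \/ (c = -1 /\ case_ii n psi))).
Proof.
  intros Hc He Hk Hyp HH. rewrite <- in_umbilic_cases by assumption.
  assert (Hn : (0 < n)%nat) by lia.
  assert (ch := fun a => hypersurface_chart n c eps M I U x psi N a Hc He Hyp).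
  destruct (Hk_constant_acoef n c eps k M I U x psi N He HH) as [ak Hak].
  destruct Hyp as (Hat & _ & Hcon & _).
  assert (cover : forall m, exists a p, U a p /\ x a p = m) by apply Hat.
  split.
  - intros [A [b [HA [Hb HL]]]].
    destruct (classic (inhabited M)) as [[m0]|Hempty];
      [|apply empty_in_umbilic; try assumption; intros m; apply Hempty; constructor; exact m].
    (* The constant term of the equation is itself the normal of the hyperplane. *)
    exists b, (inner c n b (psi m0)).
    assert (HL' : forall a p r, U a p -> (r < n + 2)%nat ->
      eps * trPS n c (fun q => psi (x a q)) (fun q => N (x a q)) k p * N (x a p) r
      + (- (c * (INR (n - k) * ak))) * psi (x a p) r = mvec n A (psi (x a p)) r + b r).
    { intros a p r Hp Hr. unfold mvec. rewrite <- (HL a p Hp r Hr).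
      rewrite (Lk_coordinate n c eps (U a) _ _ (ch a)) by assumption.
      rewrite (Hak a p Hp). ring. }
    assert (tau_const : forall m, inner c n b (psi m) = inner c n b (psi m0)).
    { intros m. apply (connected_constant n U x (fun m => inner c n b (psi m)) Hat Hcon).
      intros a p i Hp Hi.
      rewrite <- (affine_orthogonal n c eps (U a) (fun q => psi (x a q)) (fun q => N (x a q))
        A b _ _ (ch a) HA (HL' a) p i Hp Hi).
      apply (has_pd_inner_const n c (U a)); try assumption.
      apply (chart_smooth_X _ _ _ _ _ _ (ch a)). }
    destruct (cover m0) as [a [p [Hp _]]].
    assert (Ht : inner c n b (psi m0) <> 0).
    { intros E.
      apply (affine_not_geodesic n c eps k (U a) (fun q => psi (x a q)) (fun q => N (x a q))
        A b _ p Hk (ch a) HA Hb (HL' a)); [|assumption].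
      intros q _. rewrite tau_const. exact E. }
    repeat split; try assumption.
    apply (umbilic_not_totally_geodesic n c eps (U a) _ _ b _ p Hn (ch a)); try assumption.
    intros q _. apply tau_const.
  - intros [a [tau [Ha [Ht [Hne Htau]]]]].
    destruct (classic (inhabited M)) as [[m0]|Hempty].
    + pose (nu := inner c n a (N m0)).
      assert (nu_const : forall m, inner c n a (N m) = nu).
      { intros m. apply (connected_constant n U x (fun m => inner c n a (N m)) Hat Hcon).
        intros d p i Hp Hi.
        apply (umbilic_normal_constant n c eps (U d) (fun q => psi (x d q)) _ (ch d) a tau);
          auto. }
      destruct (cover m0) as [d [p [Hp _]]].
      assert (Hnu : nu <> 0).
      { intros E. apply Hne.
        rewrite (umbilic_norm n c eps (U d) _ _ (ch d) a tau p) by auto.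
        rewrite (nu_const (x d p)), E. ring. }
      pose (lam := c * tau * eps / nu). pose (T := INR (n - k) * ak).
      assert (HLk : forall d p r, U d p -> (r < n + 2)%nat ->
        Lk n c (fun q => psi (x d q)) (fun q => N (x d q)) k (fun q => psi (x d q) r) p
        = T * lam / nu * a r + (- (T * lam * c * tau / nu) - c * T) * psi (x d p) r
        /\ T <> 0).
      { intros d' p' r Hp' Hr.
        destruct (umbilic_Lk n c eps k (U d') (fun q => psi (x d' q)) (fun q => N (x d' q))
          a tau p' r Hk (ch d')) as [E1 E2]; auto.
        - rewrite nu_const. exact Hnu.
        - rewrite (Hak d' p' Hp'), nu_const in E1. rewrite (Hak d' p' Hp') in E2.
          split; [exact E1|exact (E2 Ht)]. }
      (* [A] is a scalar matrix, hence self-adjoint, and [b] a multiple of [a]; both are constant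
         because $\nu$ and $a_k$ are. *)
      exists (fun r s => (- (T * lam * c * tau / nu) - c * T) * idm s r),
        (fun r => T * lam / nu * a r).
      assert (scalE : forall r (u : vec), (r < n + 2)%nat ->
        sumR (n + 2) (fun s => (- (T * lam * c * tau / nu) - c * T) * idm s r * u s)
        = (- (T * lam * c * tau / nu) - c * T) * u r).
      { intros r u Hr. rewrite <- (sumR_idm (n + 2) u r Hr), <- sumR_scal.
        apply sumR_ext. intros. ring. }
      split; [|split].
      * intros u v.
        rewrite (inner_ext c n _ _ v v (fun r Hr => scalE r u Hr) (fun _ _ => eq_refl)).
        rewrite (inner_ext c n u u _ _ (fun _ _ => eq_refl) (fun r Hr => scalE r v Hr)).
        rewrite (inner_sym c n u), !inner_scal_l, (inner_sym c n u). reflexivity.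
      * destruct Ha as [r [Hr Har]]. exists r. split; [assumption|].
        destruct (HLk d p r Hp Hr) as [_ HT].
        (* [T] is made opaque so that its nonvanishing is taken from [HT] rather than sought factor
           by factor. *)
        clearbody T. unfold lam, Rdiv.
        repeat apply Rmult_integral_contrapositive_currified; try assumption;
          try (apply Rinv_neq_0_compat; assumption); lra.
      * intros d' p' Hp' r Hr. destruct (HLk d' p' r Hp' Hr) as [E _].
        rewrite E, scalE by assumption. ring.
    (* On an empty $M$ the equation is vacuous, and any nonzero vector serves as [b]. *)
    + exists (fun _ _ => 0), (fun r => idm r 0). split; [|split].
      * intros u v. rewrite inner_0_l, inner_sym, inner_0_l; [reflexivity| |];
          intros r Hr; apply sumR_0; intros; ring.
      * exists 0%nat. split; [lia|]. rewrite idm_same. lra.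
      * intros d p. exfalso. apply Hempty. constructor. exact (x d p).
Qed.
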